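(* Let $K\subset\mathbb{R}^d$ ($d=2,3$) be a simplex with set of faces $\mathcal{F}_K$, let $\mathrm{p}\ge0$, and let $\kappa_K>0$, $\eta_K>0$ be real constants. For each $F\in\mathcal{F}_K$ let $\mathcal{A}_F:\mathcal{P}_\mathrm{p}(F)\to\mathcal{P}_\mathrm{p}(F)$ be a linear operator that is positive and self-adjoint. Given data $\widehat{p}_F\in\mathcal{P}_\mathrm{p}(F)$ for all $F\in\mathcal{F}_K$, consider the problem: find $(p_K,\mathbf{u}_K)\in\mathcal{P}_\mathrm{p}(K)\times\boldsymbol{\mathcal{P}}_\mathrm{p}(K)$ such that for all $(q_K,\mathbf{v}_K)\in\mathcal{P}_\mathrm{p}(K)\times\boldsymbol{\mathcal{P}}_\mathrm{p}(K)$, $$-\imath(\kappa_K\eta_K^{-1}p_K,q_K)_K-(\mathbf{u}_K,\nabla q_K)_K+\sum_{F\in\mathcal{F}_K}\langle \mathbf{n}_{K,F}\cdot\mathbf{u}_K+\mathcal{A}_F^{-1}p_K,\,q_K\rangle_F=\sum_{F\in\mathcal{F}_K}\langle\mathcal{A}_F^{-1}\widehat{p}_F,q_K\rangle_F,$$ $$-\imath(\kappa_K\eta_K\mathbf{u}_K,\mathbf{v}_K)_K-(p_K,\nabla\cdot\mathbf{v}_K)_K=-\sum_{F\in\mathcal{F}_K}\langle\widehat{p}_F,\mathbf{n}_{K,F}\cdot\mathbf{v}_K\rangle_F.$$ Then this problem is well-posed: for every choice of data it has a unique solution.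
   Context: $\mathcal{P}_\mathrm{p}(\cdot)$ and $\boldsymbol{\mathcal{P}}_\mathrm{p}(\cdot)$ denote spaces of complex-valued scalar and $\mathbb{C}^d$-valued polynomials of degree at most $\mathrm{p}$. $(u,v)_K:=\int_K u\overline{v}\,dx$, $(\mathbf{u},\mathbf{v})_K:=\int_K\mathbf{u}\cdot\overline{\mathbf{v}}\,dx$, $\langle u,v\rangle_F:=\int_F u\overline{v}\,d\sigma$. $\mathbf{n}_{K,F}$ is the (constant) unit normal to $F$ pointing outward from $K$; traces of $p_K$ and $\mathbf{n}_{K,F}\cdot\mathbf{u}_K$ on $F$ belong to $\mathcal{P}_\mathrm{p}(F)$, so $\mathcal{A}_F^{\pm1}$ may be applied to them. ''Positive'' for $\mathcal{A}_F$ means $\langle\mathcal{A}_F\phi,\phi\rangle_F>0$ for all nonzero $\phi\in\mathcal{P}_\mathrm{p}(F)$; self-adjoint is with respect to $\langle\cdot,\cdot\rangle_F$. *)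

(* Defs.v *)
From mathcomp Require Import all_boot all_order all_algebra.
From mathcomp Require Import all_classical all_reals all_analysis.
From mathcomp.real_closed Require Export complex.
Set Implicit Arguments. Unset Strict Implicit. Unset Printing Implicit Defensive.
Import Order.TTheory GRing.Theory Num.Theory.
Local Open Scope ring_scope.
Local Open Scope classical_set_scope.

Section Defs.
Variable R : realType.
Local Notation C := (complex R).

Definition toC (x : R) : C := Complex x 0.

Definition dotR (n : nat) (a b : 'rV[R]_n) : R := \sum_(i < n) a 0 i * b 0 i.

Definition row_of_seq (n : nat) (xs : seq R) : 'rV[R]_n := \row_(i < n) nth 0 xs i.

(* Lebesgue integral over the n-dimensional reference simplex
   { t in R^n | t_i >= 0, t_1 + ... + t_n <= r }, computed by Fubini
   as iterated one-dimensional Lebesgue integrals. *)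
Fixpoint simplexInt (n : nat) (r : R) (g : seq R -> R) : R :=
  match n with
  | 0 => g [::]
  | n'.+1 => Rintegral lebesgue_measure `[0, r]%classic
               (fun t => simplexInt n' (r - t) (fun xs => g (t :: xs)))
  end.

Definition cSimplexInt (n : nat) (g : seq R -> C) : C :=
  Complex (simplexInt n 1 (fun xs => complex.Re (g xs)))
          (simplexInt n 1 (fun xs => complex.Im (g xs))).

Definition isPoly (n p : nat) (f : 'rV[R]_n -> C) : Prop :=
  exists c : {ffun {ffun 'I_n -> 'I_p.+1} -> C},
    forall x : 'rV[R]_n,
      f x = \sum_(a : {ffun 'I_n -> 'I_p.+1} | (\sum_(i < n) (a i : nat) <= p)%N)
              c a * \prod_(i < n) toC (x 0 i) ^+ (a i : nat).

(* ---- the simplex K with vertices v 0, ..., v d (nat-indexed) ---- *)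
(* Jacobian of the affine map from the reference simplex onto K *)
Definition jacK (d : nat) (v : nat -> 'rV[R]_d) : 'M[R]_d :=
  \matrix_(i < d, k < d) (v i.+1 - v 0%N) 0 k.

Definition mapK (d : nat) (v : nat -> 'rV[R]_d) (t : 'rV[R]_d) : 'rV[R]_d :=
  v 0%N + \sum_(i < d) t 0 i *: (v i.+1 - v 0%N).

(* L^2(K) inner product (f, g)_K = int_K f conj(g) dx *)
Definition ipK (d : nat) (v : nat -> 'rV[R]_d) (f g : 'rV[R]_d -> C) : C :=
  toC `|\det (jacK v)| *
  cSimplexInt d (fun xs => f (mapK v (row_of_seq d xs)) *
                           conjc (g (mapK v (row_of_seq d xs)))).

Definition ipKvec (d : nat) (v : nat -> 'rV[R]_d) (u w : 'I_d -> 'rV[R]_d -> C) : C :=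
  \sum_(i < d) ipK v (u i) (w i).

(* ---- faces: face j (j = 0..d) is the face opposite to vertex v j ---- *)
Definition faceVert (d : nat) (v : nat -> 'rV[R]_d) (j k : nat) : 'rV[R]_d :=
  nth 0 [seq v i | i <- iota 0 d.+1 & i != j] k.

Definition mapF (d : nat) (v : nat -> 'rV[R]_d) (j : nat) (s : 'rV[R]_d.-1) : 'rV[R]_d :=
  faceVert v j 0 + \sum_(k < d.-1) s 0 k *: (faceVert v j k.+1 - faceVert v j 0).

(* Gram matrix of the parametrization; sqrt(det) is the surface element *)
Definition gramF (d : nat) (v : nat -> 'rV[R]_d) (j : nat) : 'M[R]_d.-1 :=
  \matrix_(k < d.-1, l < d.-1)
     dotR (faceVert v j k.+1 - faceVert v j 0) (faceVert v j l.+1 - faceVert v j 0).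

(* Elements of P_p(F) are represented through the parametrization mapF,
   i.e. as functions of the parameter s in R^(d-1).
   L^2(F) inner product <phi, psi>_F = int_F phi conj(psi) dsigma. *)
Definition ipF (d : nat) (v : nat -> 'rV[R]_d) (j : nat) (phi psi : 'rV[R]_d.-1 -> C) : C :=
  toC (Num.sqrt (\det (gramF v j))) *
  cSimplexInt d.-1 (fun xs => phi (row_of_seq d.-1 xs) * conjc (psi (row_of_seq d.-1 xs))).

Definition traceF (d : nat) (v : nat -> 'rV[R]_d) (j : nat) (f : 'rV[R]_d -> C)
  : 'rV[R]_d.-1 -> C := fun s => f (mapF v j s).

Definition outward_unit_normal (d : nat) (v : nat -> 'rV[R]_d) (j : nat) (n : 'rV[R]_d) : Prop :=
  (forall k, (k < d.-1)%N -> dotR n (faceVert v j k.+1 - faceVert v j 0) = 0) /\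
  dotR n n = 1 /\
  dotR n (v j - faceVert v j 0) < 0.

Definition unitvec (d : nat) (i : 'I_d) : 'rV[R]_d := \row_(k < d) (if k == i then 1 else 0).

Definition partialC (d : nat) (i : 'I_d) (f : 'rV[R]_d -> C) : 'rV[R]_d -> C :=
  fun x => Complex ('D_(unitvec i) (fun y => complex.Re (f y)) x)
                   ('D_(unitvec i) (fun y => complex.Im (f y)) x).

Definition gradC (d : nat) (f : 'rV[R]_d -> C) : 'I_d -> 'rV[R]_d -> C :=
  fun i => partialC i f.

Definition divC (d : nat) (u : 'I_d -> 'rV[R]_d -> C) : 'rV[R]_d -> C :=
  fun x => \sum_(i < d) partialC i (u i) x.

Definition ndot (d : nat) (n : 'rV[R]_d) (u : 'I_d -> 'rV[R]_d -> C) : 'rV[R]_d -> C :=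
  fun x => \sum_(i < d) toC (n 0 i) * u i x.

Definition faceOp_ok (d p : nat) (v : nat -> 'rV[R]_d) (j : nat)
  (A : ('rV[R]_d.-1 -> C) -> ('rV[R]_d.-1 -> C)) : Prop :=
  (forall phi, isPoly p phi -> isPoly p (A phi)) /\
  (forall (a : C) phi psi, isPoly p phi -> isPoly p psi ->
      A (fun s => a * phi s + psi s) = (fun s => a * A phi s + A psi s)) /\
  (forall phi psi, isPoly p phi -> isPoly p psi ->
      ipF v j (A phi) psi = ipF v j phi (A psi)) /\
  (forall phi, isPoly p phi -> phi <> (fun _ => 0) ->
      0 < ipF v j (A phi) phi).

Definition faceInv_ok (d p : nat)
  (A Ainv : ('rV[R]_d.-1 -> C) -> ('rV[R]_d.-1 -> C)) : Prop :=
  forall phi, isPoly p phi -> isPoly p (Ainv phi) /\ A (Ainv phi) = phi.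

Definition local_eqs (d p : nat) (v : nat -> 'rV[R]_d) (kappa eta : R)
  (n : nat -> 'rV[R]_d) (Ainv : nat -> ('rV[R]_d.-1 -> C) -> ('rV[R]_d.-1 -> C))
  (phat : nat -> 'rV[R]_d.-1 -> C)
  (pK : 'rV[R]_d -> C) (uK : 'I_d -> 'rV[R]_d -> C) : Prop :=
  (forall qK : 'rV[R]_d -> C, isPoly p qK ->
     - 'i * toC (kappa / eta) * ipK v pK qK
     - ipKvec v uK (gradC qK)
     + \sum_(j < d.+1)
         ipF v j (fun s => traceF v j (ndot (n j) uK) s + Ainv j (traceF v j pK) s)
                 (traceF v j qK)
     = \sum_(j < d.+1) ipF v j (Ainv j (phat j)) (traceF v j qK)) /\
  (forall vK : 'I_d -> 'rV[R]_d -> C, (forall i, isPoly p (vK i)) ->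
     - 'i * toC (kappa * eta) * ipKvec v uK vK
     - ipK v pK (divC vK)
     = - \sum_(j < d.+1) ipF v j (phat j) (traceF v j (ndot (n j) vK))).

End Defs.

(* Main.v *)
Require Import Defs.
From mathcomp Require Import all_boot all_order all_algebra fingroup perm.
From mathcomp Require Import all_classical all_reals all_analysis.
From mathcomp.real_closed Require Import complex.
From mathcomp Require Import ring.
Import Order.TTheory GRing.Theory Num.Theory.
Import numFieldNormedType.Exports.
Local Open Scope ring_scope.
Set Implicit Arguments. Unset Strict Implicit. Unset Printing Implicit Defensive.

(** The system is square, so it suffices to show that the homogeneous problem
    has only the trivial solution.  Testing it with the solution itself and
    integrating by parts leaves [sum_F <A_F^-1 p, p>_F] plus purely imaginary
    terms, so [p] vanishes on the boundary.  The equations then hold strongly,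
    [grad p = i kappa eta u] and [div u = i (kappa / eta) p], and since each
    derivative lowers the degree, [p] and [u] must vanish.

    Integration by parts for polynomials is read off from Dirichlet's formula
    [int prod_j lambda_j ^ a_j = prod_j a_j! / (n + sum_j a_j)!] for barycentric
    monomials on the reference simplex, together with the identity
    [|F_j| n_j = - |K| grad lambda_j] in which [|F_j|] and [|K|] denote the
    Jacobians of the parametrizations. *)

(** * Integration over the reference simplex *)

(** The inner products are defined by iterated Lebesgue integrals. Rather than proving
    integrability, the development carries whole linear combinations of monomials through the
    recursion, so that linearity and conjugation follow from closed formulas. The volume terms are
    seen to be imaginary only after conjugating the second equation: its coupling term then becomes
    [(div u, p)], which also appears in the first equation after integration by parts, and can be
    eliminated. The strong equations follow because each residual has degree at most [p], hence is
    itself an admissible test function. No basis of the polynomial space is chosen: coefficient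
    vectors also have entries for exponents above the total degree, so the square matrix may be
    singular although the problem is uniquely solvable, and existence is proved for such systems. *)

Lemma poly_eq0_of_inj_roots (F : idomainType) (P : {poly F}) (x : nat -> F) :
  injective x -> (forall k, P.[x k] = 0) -> P = 0.
Proof.
move=> injx Px0; apply/eqP; apply: contraT => P0.
have := @max_poly_roots F P (map x (iota 0 (size P))) P0.
rewrite size_map size_iota ltnn; apply.
  by apply/allP => _ /mapP[k _ ->]; apply/rootP.
by rewrite map_inj_uniq ?iota_uniq.
Qed.

Section SimplexIntegral.
Variable R : realType.
Implicit Types (r : R) (P Q : {poly R}) (xs : seq R) (g : seq R -> R).
Local Notation mu := (@lebesgue_measure R).

Lemma Rintegral_deriv_horner Q r : 0 <= r ->
  Rintegral mu `[0, r]%classic (horner Q^`()) = Q.[r] - Q.[0].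
Proof.
rewrite le_eqVlt => /predU1P[<-|r0].
  by rewrite set_itv1 Rintegral_set1 subrr.
suff E : (\int[mu]_(x in `[0%R, r]) (Q^`().[x])%:E = (Q.[r])%:E - (Q.[0])%:E)%E.
  by rewrite /Rintegral E.
apply: continuous_FTC2 => //.
- by apply: continuous_subspaceT => x; exact: continuous_horner.
- split; first by move=> x _; exact: derivable_horner.
  + by apply: cvg_at_right_filter; exact: continuous_horner.
  + by apply: cvg_at_left_filter; exact: continuous_horner.
- by move=> x _; rewrite derivE.
Qed.

(** A nonnegative derivative makes [Q] monotone on [[0, r]]; equal end values make it constant
    there, hence constant as a polynomial. This is why [t] may be arbitrary. *)
Lemma horner_eq0_of_Rintegral_eq0 Q r t : 0 < r ->
  (forall s : R, 0 <= s <= r -> 0 <= Q^`().[s]) ->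
  Rintegral mu `[0, r]%classic (horner Q^`()) = 0 -> Q^`().[t] = 0.
Proof.
move=> r0 dQ; rewrite Rintegral_deriv_horner ?ltW// => /eqP; rewrite subr_eq0.
move=> /eqP Qr0.
have Qhomo : {in `[0, r] &, {homo (horner Q) : x y / x <= y}}.
  apply: ger0_derive1_le_cc.
  - by move=> x _; exact: derivable_horner.
  - move=> x; rewrite in_itv/= => /andP[x0 xr].
    by rewrite -derivE dQ// !ltW.
  - by apply: continuous_subspaceT => x; exact: continuous_horner.
suff -> : Q = (Q.[0])%:P by rewrite derivC horner0.
apply/eqP; rewrite -subr_eq0; apply/eqP.
(* The points [r / k.+1] are infinitely many elements of [[0, r]]. *)
apply: (@poly_eq0_of_inj_roots _ _ (fun k => r / k.+1%:R)).
  move=> j k /(mulfI (lt0r_neq0 r0)) /invr_inj /eqP.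
  by rewrite eqr_nat => /eqP[].
move=> k; rewrite !hornerE.
have s0 : 0 <= r / k.+1%:R by rewrite divr_ge0 ?ltW.
have sr : r / k.+1%:R <= r by rewrite ler_pdivrMr// ler_pMr// ler1n.
apply/eqP; rewrite subr_eq0 eq_le; apply/andP; split.
  by rewrite -Qr0; apply: Qhomo; rewrite ?in_itv/= ?s0 ?sr ?lexx ?(ltW r0).
by apply: Qhomo; rewrite ?in_itv/= ?s0 ?sr ?lexx ?(ltW r0).
Qed.

(* A primitive of [t ^ a * (r - t) ^ e], obtained by repeated integration by
   parts. *)
Fixpoint beta_primitive r (e a : nat) : {poly R} :=
  if e is e'.+1 then
    a.+1%:R^-1 *: ('X^(a.+1) * (r%:P - 'X) ^+ e + e%:R *: beta_primitive r e' a.+1)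
  else a.+1%:R^-1 *: 'X^(a.+1).

Lemma deriv_beta_primitive r e a :
  (beta_primitive r e a)^`() = 'X^a * (r%:P - 'X) ^+ e.
Proof.
elim: e a => [|e IH] a /=.
  by rewrite derivZ derivXn expr0 mulr1 -scalerMnr scalerMnl -mulr_natr mulVf ?scale1r.
rewrite derivZ derivD derivZ IH derivM derivXn deriv_exp derivB derivC derivX.
rewrite /= sub0r mulN1r mulNrn mulrN mulrnAr scaler_nat addrNK.
by rewrite mulrnAl -scalerMnr scalerMnl -mulr_natr mulVf ?scale1r.
Qed.

(** The Beta integral scaled to [[0, r]]. The boundary term of each integration by parts vanishes at
    both ends, so each step trades one unit of [e] for one of [a]. *)
Lemma beta_primitive_eval r e a :
  (beta_primitive r e a).[r] - (beta_primitive r e a).[0] =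
  (a`! * e`!)%N%:R / (a + e).+1`!%:R * r ^+ (a + e).+1.
Proof.
have n0 k : k.+1%:R != 0 :> R by rewrite pnatr_eq0.
have f0 k : k`!%:R != 0 :> R by rewrite pnatr_eq0 -lt0n fact_gt0.
elim: e a => [|e IH] a /=.
  rewrite !hornerZ !hornerXn expr0n mulr0 subr0 addn0 fact0 muln1 factS natrM.
  by congr (_ * _); field; rewrite ?nat1r ?natr1 ?n0 ?f0.
have := IH a.+1; set B := beta_primitive _ _ _ => BE.
rewrite !(hornerZ, hornerD, hornerM, hornerXn, horner_exp, hornerN, hornerX, hornerC).
rewrite subrr !expr0n /= !(mul0r, mulr0) !add0r.
rewrite -!mulrBr BE addnS -addSn (factS e) (factS a).
have := f0 (a.+1 + e).+1; move: ((a.+1 + e).+1`!%:R) (r ^+ _) => F X F0.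
by rewrite !natrM; field; rewrite ?nat1r ?natr1 ?n0 ?F0.
Qed.

(* [(r - sum xs) ^ b * prod_i xs_i ^ a_i]: a monomial in the barycentric
   coordinates of the simplex of size [r]. *)
Fixpoint bmono (b : nat) (a : seq nat) r xs : R :=
  if a is a0 :: a' then head 0 xs ^+ a0 * bmono b a' (r - head 0 xs) (behead xs)
  else r ^+ b.

Lemma bmonoE n b a r xs : size a = n -> size xs = n ->
  bmono b a r xs = (r - \sum_(i < n) xs`_i) ^+ b *
                   \prod_(i < n) xs`_i ^+ nth 0%N a i.
Proof.
elim: n a r xs => [|n IH] [|a0 a] r [|x xs] //=.
  by rewrite !big_ord0 subr0 mulr1.
move=> [sa] [sx]; rewrite (IH _ _ _ sa sx) !big_ord_recl /=.
by rewrite opprD addrA mulrCA.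
Qed.

Definition dirichlet_weight (b : nat) (a : seq nat) : R :=
  (b`! * \prod_(k <- a) k`!)%N%:R / (size a + b + sumn a)`!%:R.

Lemma simplexInt_ext n r g1 g2 :
  (forall xs, size xs = n -> g1 xs = g2 xs) ->
  simplexInt n r g1 = simplexInt n r g2.
Proof.
elim: n r g1 g2 => [|n IH] r g1 g2 E /=; first exact: E.
congr Rintegral; apply/funext => t; apply: IH => xs sx; apply: E.
by rewrite /= sx.
Qed.

(** Integrating out all coordinates but the first, [t], by Dirichlet's formula leaves powers of [t]
    times powers of [r - t]; this is a primitive of that sum. *)
Definition slice_primitive (T : Type) (l : seq T) (c : T -> R) (b : T -> nat)
    (a : T -> seq nat) n r :=
  \sum_(k <- l) (c k * dirichlet_weight (b k) (behead (a k))) *: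
     beta_primitive r (n + b k + sumn (behead (a k))) (head 0%N (a k)).

(** The whole sum goes through the induction, so additivity of the integral is never invoked. The
    second conjunct records that the slice integral is a polynomial in the first coordinate, which
    the definiteness lemma [simplexInt_eq0] needs. *)
Lemma simplexInt_bmono (T : Type) (l : seq T) (b : T -> nat) n c a r :
  (forall k, size (a k) = n) -> 0 <= r ->
  simplexInt n r (fun xs => \sum_(k <- l) c k * bmono (b k) (a k) r xs) =
  \sum_(k <- l) c k * dirichlet_weight (b k) (a k) * r ^+ (n + b k + sumn (a k))
/\ (forall m, n = m.+1 -> forall t : R, 0 <= t <= r ->
    simplexInt m (r - t)
      (fun xs => \sum_(k <- l) c k * bmono (b k) (a k) r (t :: xs)) =
    (slice_primitive l c b a m r)^`().[t]).
Proof.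
elim: n c a r => [|n IH] c a r sa r0.
  split=> //=; apply: eq_bigr => k _; move: (sa k); case: (a k) => //= _.
  rewrite /dirichlet_weight big_nil muln1 /= !addn0 add0n.
  by rewrite divff ?mulr1// pnatr_eq0 -lt0n fact_gt0.
have slice (t : R) : 0 <= t <= r ->
    simplexInt n (r - t)
      (fun xs => \sum_(k <- l) c k * bmono (b k) (a k) r (t :: xs)) =
    (slice_primitive l c b a n r)^`().[t].
  case/andP=> t0 tr.
  (* At fixed [t] the factor [t ^ a_0] joins the coefficient, leaving a sum of the same shape on the
     simplex of size [r - t]. *)
  have [/= E _] := IH (fun k => c k * t ^+ head 0%N (a k))
    (fun k => behead (a k)) (r - t) (fun k => ltac:(by rewrite size_behead sa))
    (ltac:(by rewrite subr_ge0)).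
  have -> : simplexInt n (r - t) (fun xs => \sum_(k <- l)
      c k * bmono (b k) (a k) r (t :: xs)) = simplexInt n (r - t) (fun xs =>
      \sum_(k <- l) c k * t ^+ head 0%N (a k) *
         bmono (b k) (behead (a k)) (r - t) xs).
    congr simplexInt; apply/funext => xs; apply: eq_bigr => k _.
    by move: (sa k); case: (a k) => //= a0 a' _; rewrite mulrA.
  rewrite E /slice_primitive (raddf_sum (@deriv R)) horner_sum.
  apply: eq_bigr => k _. rewrite /= derivZ deriv_beta_primitive.
  rewrite !(hornerZ, hornerD, hornerM, hornerXn, horner_exp, hornerN, hornerX, hornerC).
  by move: (dirichlet_weight _ _) (t ^+ _) ((r - t) ^+ _) => D X Y; ring.
split; last by move=> m [<-].
transitivity (Rintegral mu `[0, r]%classic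
    (horner (slice_primitive l c b a n r)^`())).
  by apply: eq_Rintegral => t; rewrite inE /= in_itv /=; exact: slice.
rewrite Rintegral_deriv_horner // /slice_primitive !horner_sum -sumrB.
apply: eq_bigr => k _; rewrite !hornerZ -mulrBr beta_primitive_eval.
move: (sa k); case: (a k) => //= a0 a' [sa'].
have f0 j : j`!%:R != 0 :> R by rewrite pnatr_eq0 -lt0n fact_gt0.
have -> : (a0 + (n + b k + sumn a')).+1 = (n.+1 + b k + (a0 + sumn a'))%N.
  by rewrite addnCA !addSn.
rewrite !mulrA; congr (_ * _); rewrite /dirichlet_weight [size (_ :: _)]/=.
rewrite [sumn (_ :: _)]/= sa' big_cons.
have := f0 (n.+1 + b k + (a0 + sumn a'))%N; move: (_ `!%:R) => F F0.
have := f0 (n + b k + sumn a')%N; move: (n + b k + sumn a')%N => N N0.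
by rewrite !natrM; field; rewrite N0 F0.
Qed.

(** Both variants are needed: nonnegativity is assumed on the closed simplex, vanishing is concluded
    on the open one. *)
Definition in_simplex (strict : bool) r xs :=
  all (fun x => if strict then 0 < x else 0 <= x) xs &&
  (if strict then \sum_(x <- xs) x < r else \sum_(x <- xs) x <= r).

Lemma simplexInt_ge0 n r g :
  (forall xs, size xs = n -> in_simplex false r xs -> 0 <= g xs) -> 0 <= r ->
  0 <= simplexInt n r g.
Proof.
rewrite /in_simplex.
elim: n r g => [|n IH] r g g0 r0 /=; first by apply: g0; rewrite //= big_nil.
apply: Rintegral_ge0 => t /=; rewrite in_itv/= => /andP[t0 tr].
apply: IH; last by rewrite subr_ge0.
move=> xs sx /andP[xs0 xsr]; apply: g0; rewrite /= ?sx// t0 xs0/= big_cons.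
by rewrite addrC -lerBrDr.
Qed.

(** The slice integral is a nonnegative polynomial in [t] with zero integral, so it vanishes for
    every [t], and the induction hypothesis applies to the slice. Strictness keeps the slice size
    [r - t] positive. *)
Lemma simplexInt_eq0 (T : Type) (l : seq T) (b : T -> nat) n c a r xs :
  (forall k, size (a k) = n) -> 0 < r ->
  let g := fun xs => \sum_(k <- l) c k * bmono (b k) (a k) r xs in
  (forall xs, size xs = n -> in_simplex false r xs -> 0 <= g xs) ->
  simplexInt n r g = 0 ->
  size xs = n -> in_simplex true r xs -> g xs = 0.
Proof.
elim: n c a r xs => [|n IH] c a r xs sa r0 g g0 Ig0.
  by move=> /size0nil ->.
case: xs => [//|t xs] [sx] /andP[/= /andP[t0 xs0]]; rewrite big_cons => txr.
have tr : t < r.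
  apply: le_lt_trans txr; rewrite lerDl big_seq sumr_ge0// => x.
  by move=> /(allP xs0) /ltW.
have [_ /(_ n erefl) slice] := @simplexInt_bmono T l b n.+1 c a r sa (ltW r0).
have slice_ge0 (s : R) : 0 <= s <= r -> forall ys, size ys = n ->
    in_simplex false (r - s) ys -> 0 <= g (s :: ys).
  move=> /andP[s0 sr] ys sy /andP[ys0 ysr]; apply: g0 => /=; first by rewrite sy.
  by apply/andP; split; rewrite /= ?s0// big_cons addrC -lerBrDr.
have sl0 : simplexInt n (r - t) (fun ys => g (t :: ys)) = 0.
  rewrite /g slice ?ltW//.
  apply: (horner_eq0_of_Rintegral_eq0 _ r0).
    move=> s /[dup] sr /slice <-; apply: simplexInt_ge0 => [ys|]; first exact: slice_ge0.
    by case/andP: sr; rewrite subr_ge0.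
  apply: etrans Ig0; apply: eq_Rintegral => s; rewrite inE /= in_itv /=.
  by move=> /slice /esym.
have gE ys : g (t :: ys) = \sum_(k <- l) c k * t ^+ head 0%N (a k) *
         bmono (b k) (behead (a k)) (r - t) ys.
  apply: eq_bigr => k _.
  by move: (sa k); case: (a k) => //= a0 a' _; rewrite mulrA.
rewrite gE; apply: IH => //.
- by move=> k; rewrite size_behead sa.
- by rewrite subr_gt0.
- by move=> ys sy iy; rewrite -gE; apply: slice_ge0 => //; rewrite !ltW.
- by apply: etrans sl0; congr simplexInt; apply/funext => ys; rewrite gE.
- by apply/andP; split=> //=; rewrite ltrBrDr addrC.
Qed.
End SimplexIntegral.

(** * Polynomial functions and their derivatives *)

Section PolynomialFunctions.
Variable R : realType.
Local Notation C := (complex R).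
Implicit Types (p q n : nat).

Lemma toC0 : toC (0 : R) = 0. Proof. by []. Qed.
Lemma toCD (x y : R) : toC (x + y) = toC x + toC y.
Proof. exact: (rmorphD (real_complex R)). Qed.
Lemma toCM (x y : R) : toC (x * y) = toC x * toC y.
Proof. exact: (rmorphM (real_complex R)). Qed.
Lemma toCX (x : R) k : toC (x ^+ k) = toC x ^+ k.
Proof. exact: (rmorphXn (real_complex R)). Qed.
Lemma toC_nat k : toC (k%:R : R) = k%:R.
Proof. exact: (rmorph_nat (real_complex R)). Qed.
Lemma toC_sum (I : Type) (r : seq I) (P : pred I) (F : I -> R) :
  toC (\sum_(i <- r | P i) F i) = \sum_(i <- r | P i) toC (F i).
Proof. exact: (rmorph_sum (real_complex R)). Qed.
Lemma toC_prod (I : Type) (r : seq I) (P : pred I) (F : I -> R) :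
  toC (\prod_(i <- r | P i) F i) = \prod_(i <- r | P i) toC (F i).
Proof. exact: (rmorph_prod (real_complex R)). Qed.
Lemma conjc_toC (x : R) : conjc (toC x) = toC x.
Proof. exact: conjc_real. Qed.
Lemma conjcD (z w : C) : conjc (z + w) = conjc z + conjc w.
Proof. exact: (rmorphD conjc). Qed.
Lemma conjcN (z : C) : conjc (- z) = - conjc z.
Proof. exact: (rmorphN conjc). Qed.
Lemma conjci : conjc ('i : C) = - 'i.
Proof. exact: conjCi. Qed.
Lemma conjcM (z w : C) : conjc (z * w) = conjc z * conjc w.
Proof. exact: (rmorphM conjc). Qed.
Lemma conjc_sum (I : Type) (r : seq I) (P : pred I) (F : I -> C) :
  conjc (\sum_(i <- r | P i) F i) = \sum_(i <- r | P i) conjc (F i).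
Proof. exact: (rmorph_sum conjc). Qed.
Lemma toC_eq0 (x : R) : (toC x == 0) = (x == 0).
Proof. by rewrite eq_complex /= eqxx andbT. Qed.

(** Exponents are plain functions, without the bound built into [isPoly], so that they can be added
    and decremented freely. *)
Definition mono n (a : 'I_n -> nat) (x : 'rV[R]_n) : C :=
  \prod_(i < n) toC (x 0 i) ^+ a i.

Lemma isPoly_lin p n (a : C) (f g : 'rV[R]_n -> C) :
  isPoly p f -> isPoly p g -> isPoly p (fun x => a * f x + g x).
Proof.
move=> [c fE] [c' gE]; exists [ffun m => a * c m + c' m] => x.
rewrite fE gE mulr_sumr -big_split /=.
by apply: eq_bigr => m _; rewrite ffunE mulrDl mulrA.
Qed.

Lemma isPoly0 p n : isPoly p (fun _ : 'rV[R]_n => 0).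
Proof. by exists [ffun _ => 0] => x; rewrite big1// => m _; rewrite ffunE mul0r. Qed.

Lemma isPolyD p n (f g : 'rV[R]_n -> C) :
  isPoly p f -> isPoly p g -> isPoly p (fun x => f x + g x).
Proof.
move=> pf pg; have := isPoly_lin 1 pf pg.
by congr isPoly; apply/funext => x; rewrite mul1r.
Qed.

Lemma isPolyZ p n (a : C) (f : 'rV[R]_n -> C) :
  isPoly p f -> isPoly p (fun x => a * f x).
Proof.
move=> pf; have := isPoly_lin a pf (isPoly0 p n).
by congr isPoly; apply/funext => x; rewrite addr0.
Qed.

Lemma isPoly_sum p n (I : Type) (r : seq I) (P : pred I) (F : I -> 'rV[R]_n -> C) :
  (forall i, P i -> isPoly p (F i)) ->
  isPoly p (fun x => \sum_(i <- r | P i) F i x).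
Proof.
move=> pF; elim: r => [|i r IH].
  have := isPoly0 p n; congr isPoly; apply/funext => x; by rewrite big_nil.
case Pi: (P i).
  have := isPolyD (pF i Pi) IH.
  by congr isPoly; apply/funext => x; rewrite big_cons Pi.
by move: IH; congr isPoly; apply/funext => x; rewrite big_cons Pi.
Qed.

Lemma isPoly_mono p n (a : 'I_n -> nat) : (\sum_(i < n) a i <= p)%N -> isPoly p (mono a).
Proof.
move=> ap.
have aip i : (a i < p.+1)%N by rewrite ltnS (leq_trans _ ap)// (bigD1 i)//= leq_addr.
pose a0 : {ffun 'I_n -> 'I_p.+1} := [ffun i => inord (a i)].
have a0E i : (a0 i : nat) = a i by rewrite ffunE inordK.
exists [ffun m => (m == a0)%:R] => x.
rewrite (bigD1 a0) /=; last by rewrite (eq_bigr _ (fun i _ => a0E i)).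
rewrite ffunE eqxx mul1r [X in _ + X]big1 ?addr0.
  by rewrite /mono; apply: eq_bigr => i _; rewrite a0E.
by move=> m /andP[_ /negbTE ma]; rewrite ffunE ma mul0r.
Qed.

Lemma isPoly_le p q n (f : 'rV[R]_n -> C) : (p <= q)%N -> isPoly p f -> isPoly q f.
Proof.
move=> pq [c fE]; rewrite (_ : f = fun x =>
   \sum_(m : {ffun 'I_n -> 'I_p.+1} | (\sum_(i < n) (m i : nat) <= p)%N)
     c m * mono (fun i => m i) x); last exact/funext.
by apply: isPoly_sum => m mp; apply/isPolyZ/isPoly_mono/(leq_trans mp).
Qed.

Lemma monoD n (a b : 'I_n -> nat) x :
  mono a x * mono b x = mono (fun i => a i + b i)%N x.
Proof. by rewrite /mono -big_split /=; apply: eq_bigr => i _; rewrite exprD. Qed.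

Lemma isPolyM p q n (f g : 'rV[R]_n -> C) :
  isPoly p f -> isPoly q g -> isPoly (p + q) (fun x => f x * g x).
Proof.
move=> [c fE] [c' gE]; rewrite (_ : (fun x => f x * g x) = fun x =>
   \sum_(m : {ffun 'I_n -> 'I_p.+1} | (\sum_(i < n) (m i : nat) <= p)%N)
   \sum_(k : {ffun 'I_n -> 'I_q.+1} | (\sum_(i < n) (k i : nat) <= q)%N)
     (c m * c' k) * mono (fun i => m i + k i)%N x); last first.
  apply/funext => x; rewrite fE gE mulr_suml; apply: eq_bigr => m _.
  rewrite mulr_sumr; apply: eq_bigr => k _; rewrite -monoD /mono.
  by rewrite mulrACA.
apply: isPoly_sum => m mp; apply: isPoly_sum => k kq.
by apply/isPolyZ/isPoly_mono; rewrite big_split leq_add.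
Qed.

Lemma isPoly_cst p n (a : C) : isPoly p (fun _ : 'rV[R]_n => a).
Proof.
have : isPoly p (mono (fun _ : 'I_n => 0%N)) by apply: isPoly_mono; rewrite big1.
move=> /(isPolyZ a); congr isPoly; apply/funext => x.
by rewrite /mono big1 ?mulr1// => i _; rewrite expr0.
Qed.

Lemma isPoly_coord n (i : 'I_n) : isPoly 1 (fun x : 'rV[R]_n => toC (x 0 i)).
Proof.
have : isPoly 1 (mono (fun k : 'I_n => (k == i : nat))).
  apply: isPoly_mono; rewrite (bigD1 i)//= eqxx big1 ?addn0// => k /negbTE ki.
  by rewrite ki.
congr isPoly; apply/funext => x; rewrite /mono (bigD1 i)//= eqxx big1 ?mulr1//.
by move=> k /negbTE ->; rewrite expr0.
Qed.

Lemma isPolyX p n k (f : 'rV[R]_n -> C) :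
  isPoly p f -> isPoly (k * p) (fun x => f x ^+ k).
Proof.
move=> pf; elim: k => [|k IH]; first exact: isPoly_cst.
by rewrite mulSn; have := isPolyM pf IH; congr isPoly; apply/funext => x; rewrite exprS.
Qed.

Lemma isPoly_prod n (I : Type) (r : seq I) (d : I -> nat) (F : I -> 'rV[R]_n -> C) :
  (forall i, isPoly (d i) (F i)) ->
  isPoly (\sum_(i <- r) d i) (fun x => \prod_(i <- r) F i x).
Proof.
move=> pF; elim: r => [|i r IH].
  have := isPoly_cst (\sum_(i <- [::]) d i) n 1.
  by congr isPoly; apply/funext => x; rewrite big_nil.
rewrite big_cons; have := isPolyM (pF i) IH.
by congr isPoly; apply/funext => x; rewrite big_cons.
Qed.

(** Serves the parametrizations [mapK] and [mapF] as well as the passage to barycentric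
    coordinates. *)
Lemma isPoly_comp p n k (f : 'rV[R]_n -> C) (phi : 'rV[R]_k -> 'rV[R]_n) :
  (forall i, isPoly 1 (fun s => toC (phi s 0 i))) ->
  isPoly p f -> isPoly p (fun s => f (phi s)).
Proof.
move=> pphi [c fE]; rewrite (_ : (fun s => f (phi s)) = fun s =>
   \sum_(m : {ffun 'I_n -> 'I_p.+1} | (\sum_(i < n) (m i : nat) <= p)%N)
     c m * \prod_(i < n) toC (phi s 0 i) ^+ m i); last by apply/funext => s; rewrite fE.
apply: isPoly_sum => m mp; apply: isPolyZ; apply: (isPoly_le mp).
apply: isPoly_prod => i; rewrite -[X in isPoly X]muln1; exact: isPolyX.
Qed.

Lemma isPoly_affine n (b : R) (g : 'I_n -> R) :
  isPoly 1 (fun x : 'rV[R]_n => toC (b + \sum_k x 0 k * g k)).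
Proof.
have := isPolyD (isPoly_cst 1 n (toC b))
  (@isPoly_sum 1 n _ (index_enum 'I_n) xpredT (fun k x => toC (g k) * toC (x 0 k))
    (fun k _ => isPolyZ (toC (g k)) (isPoly_coord k))).
congr isPoly; apply/funext => x; rewrite toCD toC_sum; congr (_ + _).
by apply: eq_bigr => k _; rewrite toCM mulrC.
Qed.

Lemma isPoly_conj p n (f : 'rV[R]_n -> C) :
  isPoly p f -> isPoly p (fun x => conjc (f x)).
Proof.
move=> [c fE]; exists [ffun m => conjc (c m)] => x.
rewrite fE rmorph_sum; apply: eq_bigr => m _; rewrite rmorphM ffunE; congr (_ * _).
rewrite rmorph_prod; apply: eq_bigr => i _.
by rewrite rmorphXn; congr (_ ^+ _); exact: conjc_toC.
Qed.

(** * Partial derivatives of polynomial functions *)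

Section Derivatives.
Variable d : nat.
Implicit Types (i : 'I_d) (x y w : 'rV[R]_d) (f g : 'rV[R]_d -> C).

Lemma is_derive_affine x w (b : R) (g : 'I_d -> R) :
  is_derive x w (fun y : 'rV[R]_d => b + \sum_k y 0 k * g k) (\sum_k w 0 k * g k).
Proof.
(* The difference quotient of an affine function does not depend on the increment. *)
have E : forall h : R, h != 0 -> h^-1 *: ((b + \sum_k (h *: w + x) 0 k * g k) -
     (b + \sum_k x 0 k * g k)) = \sum_k w 0 k * g k.
  move=> h h0; rewrite opprD addrACA subrr add0r -sumrB.
  rewrite (eq_bigr (fun k => h * (w 0 k * g k))) => [|k _]; last by rewrite !mxE; ring.
  by rewrite -mulr_sumr scalerA mulVf ?scale1r.
have cv : ((fun h : R => h^-1 *: ((fun y : 'rV[R]_d => b + \sum_k y 0 k * g k) (h *: w + x) -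
   (b + \sum_k x 0 k * g k))) @ 0^' --> (\sum_k w 0 k * g k : R))%classic.
  apply: cvg_near_cst; near=> h; apply: E.
  by near: h; exact: nbhs_dnbhs_neq.
apply: DeriveDef; first by apply/cvg_ex; exists (\sum_k w 0 k * g k).
exact: cvg_lim.
Unshelve. all: by end_near. Qed.

Lemma is_derive_mul (f1 f2 : 'rV[R]_d -> R) (d1 d2 : R) x w :
  is_derive x w f1 d1 -> is_derive x w f2 d2 ->
  is_derive x w (fun y => f1 y * f2 y) (f1 x * d2 + f2 x * d1).
Proof. by move=> h1 h2; exact: (is_deriveM h1 h2). Qed.

Lemma is_derive_pow (f : 'rV[R]_d -> R) (df : R) k x w : is_derive x w f df ->
  is_derive x w (fun y => f y ^+ k) (k%:R * f x ^+ k.-1 * df).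
Proof.
move=> h; rewrite (_ : (fun y => _) = f ^+ k); first exact: (is_deriveX k h).
by rewrite exprfctE.
Qed.

Lemma is_derive_prod n (h : 'I_n -> 'rV[R]_d -> R) (dh : 'I_n -> R) x w :
  (forall k, is_derive x w (h k) (dh k)) ->
  is_derive x w (fun y => \prod_k h k y)
    (\sum_j dh j * \prod_(k | k != j) h k x).
Proof.
elim: n h dh => [|n IH] h dh dhk.
  rewrite big_ord0; under eq_fun do rewrite big_ord0.
  exact: is_derive_cst.
under eq_fun do rewrite big_ord_recl.
have IHn := IH (fun k => h (lift ord0 k)) (fun k => dh (lift ord0 k))
  (fun k => dhk (lift ord0 k)).
apply: (is_derive_eq (is_derive_mul (dhk ord0) IHn)).
rewrite big_ord_recl addrC /=; congr (_ + _).
  by rewrite [RHS]mulrC [in RHS]big_mkcond big_ord_recl /= mul1r.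
rewrite mulr_sumr; apply: eq_bigr => j _; rewrite [in RHS]big_mkcond big_ord_recl /=.
rewrite [LHS]mulrCA; congr (_ * (_ * _)); rewrite [in LHS]big_mkcond; apply: eq_bigr => k _.
by rewrite (inj_eq (@lift_inj _ ord0)).
Qed.

(** Subtracting the boolean [k == j] lowers only the exponent of index [j]. If that exponent is 0
    the subtraction truncates, and the factor [a j] kills the term. *)
Lemma is_derive_prodX n (h : 'I_n -> 'rV[R]_d -> R) (dh : 'I_n -> R) (a : 'I_n -> nat) x w :
  (forall k, is_derive x w (h k) (dh k)) ->
  is_derive x w (fun y => \prod_k h k y ^+ a k)
    (\sum_j (a j)%:R * dh j * \prod_k h k x ^+ (a k - (k == j))).
Proof.
move=> dhk; apply: (is_derive_eq (@is_derive_prod n (fun k y => h k y ^+ a k) _ x w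
  (fun k => is_derive_pow (a k) (dhk k)))).
apply: eq_bigr => j _; rewrite [in RHS](bigD1 j)//= eqxx subn1 /=.
rewrite (eq_bigr (fun k => h k x ^+ (a k - (k == j)))) => [|k /negbTE ->]; last first.
  by rewrite subn0.
by rewrite [in RHS]mulrA; congr (_ * _); rewrite mulrAC.
Qed.

(** [partialC] is a total function whose value says nothing about existence of the derivative; this
    relation carries both, as the calculus rules require. *)
Definition has_partial i f x (l : C) :=
  is_derive x (unitvec R i) (fun y => complex.Re (f y)) (complex.Re l) /\
  is_derive x (unitvec R i) (fun y => complex.Im (f y)) (complex.Im l).

Lemma has_partialE i f x l : has_partial i f x l -> partialC i f x = l.
Proof. by case: l => a b [/= [_ Ha] [_ Hb]]; rewrite /partialC Ha Hb. Qed.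

Lemma has_partialD i f g x l m : has_partial i f x l -> has_partial i g x m ->
  has_partial i (fun y => f y + g y) x (l + m).
Proof.
move=> [f1 f2] [g1 g2]; split.
  under eq_fun do rewrite raddfD /=.
  by rewrite raddfD; exact: is_deriveD.
under eq_fun do rewrite raddfD /=.
by rewrite raddfD; exact: is_deriveD.
Qed.

Lemma has_partialM i f g x l m : has_partial i f x l -> has_partial i g x m ->
  has_partial i (fun y => f y * g y) x (l * g x + f x * m).
Proof.
have ReM (u v : C) : complex.Re (u * v) =
  complex.Re u * complex.Re v - complex.Im u * complex.Im v by case: u; case: v.
have ImM (u v : C) : complex.Im (u * v) =
  complex.Re u * complex.Im v + complex.Im u * complex.Re v by case: u; case: v.
have ReD (u v : C) : complex.Re (u + v) = complex.Re u + complex.Re v by case: u; case: v.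
have ImD (u v : C) : complex.Im (u + v) = complex.Im u + complex.Im v by case: u; case: v.
move=> [f1 f2] [g1 g2]; split.
  under eq_fun do rewrite ReM.
  apply: (is_derive_eq (is_deriveB (is_derive_mul f1 g1) (is_derive_mul f2 g2))).
  by rewrite ReD !ReM; ring.
under eq_fun do rewrite ImM.
apply: (is_derive_eq (is_deriveD (is_derive_mul f1 g2) (is_derive_mul f2 g1))).
by rewrite ImD !ImM; ring.
Qed.

Lemma has_partial_conj i f x l : has_partial i f x l ->
  has_partial i (fun y => conjc (f y)) x (conjc l).
Proof.
have ReJ (u : C) : complex.Re (conjc u) = complex.Re u by case: u.
have ImJ (u : C) : complex.Im (conjc u) = - complex.Im u by case: u.
move=> [f1 f2]; split; first by under eq_fun do rewrite ReJ; rewrite ReJ.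
by under eq_fun do rewrite ImJ; rewrite ImJ; exact: is_deriveN.
Qed.

Lemma has_partial_cst i x (a : C) : has_partial i (fun _ => a) x 0.
Proof. by split; exact: is_derive_cst. Qed.

Lemma has_partial_toC i x (h : 'rV[R]_d -> R) (dh : R) :
  is_derive x (unitvec R i) h dh -> has_partial i (fun y => toC (h y)) x (toC dh).
Proof. by move=> dhx; split => //=; exact: is_derive_cst. Qed.

Lemma has_partial_sum i x (T : Type) (r : seq T) (P : pred T) (F : T -> 'rV[R]_d -> C) l :
  (forall k, has_partial i (F k) x (l k)) ->
  has_partial i (fun y => \sum_(k <- r | P k) F k y) x (\sum_(k <- r | P k) l k).
Proof.
move=> hF; elim: r => [|k r IH].
  rewrite big_nil (_ : (fun y => _) = fun _ => 0); first exact: has_partial_cst.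
  by apply/funext => y; rewrite big_nil.
rewrite big_cons (_ : (fun y => _) = fun y => if P k then F k y + \sum_(j <- r | P j) F j y
   else \sum_(j <- r | P j) F j y); last by apply/funext => y; rewrite big_cons.
by case: (P k) => //; exact: has_partialD.
Qed.

Lemma has_partialZ i f x l a : has_partial i f x l ->
  has_partial i (fun y => a * f y) x (a * l).
Proof. by move=> fl; have := has_partialM (has_partial_cst i x a) fl; rewrite mul0r add0r. Qed.

Lemma has_partial_mono i x n (h : 'I_n -> 'rV[R]_d -> R) (dh : 'I_n -> R) (a : 'I_n -> nat) :
  (forall k, is_derive x (unitvec R i) (h k) (dh k)) ->
  has_partial i (fun y => \prod_k toC (h k y) ^+ a k) x
    (\sum_j (a j)%:R * toC (dh j) * \prod_k toC (h k x) ^+ (a k - (k == j))).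
Proof.
move=> /(is_derive_prodX a) /has_partial_toC.
rewrite (_ : (fun y => \prod_k _) = fun y => toC (\prod_k h k y ^+ a k)); last first.
  by apply/funext => y; rewrite toC_prod; apply: eq_bigr => k _; rewrite toCX.
rewrite toC_sum (eq_bigr (fun j => (a j)%:R * toC (dh j) *
   \prod_k toC (h k x) ^+ (a k - (k == j)))) // => j _.
by rewrite !toCM toC_nat toC_prod; congr (_ * _); apply: eq_bigr => k _; rewrite toCX.
Qed.

Lemma coord_is_derive i x (k : 'I_d) :
  is_derive x (unitvec R i) (fun y : 'rV[R]_d => y 0 k) (k == i)%:R.
Proof.
have E (y : 'rV[R]_d) : 0 + \sum_j y 0 j * (j == k)%:R = y 0 k.
  rewrite add0r (bigD1 k)//= eqxx mulr1 big1 ?addr0// => j /negbTE ->.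
  by rewrite mulr0.
have := is_derive_affine x (unitvec R i) 0 (fun j => (j == k)%:R).
under eq_fun do rewrite E.
by rewrite -[X in is_derive _ _ _ X]add0r E mxE; case: ifP.
Qed.

(** The last conjunct is separate because [p.-1] is 0 for [p = 0]: the degree bound alone would not
    show that constants have zero derivative, where the final descent ends. *)
Lemma poly_partial p i f : isPoly p f -> isPoly p.-1 (partialC i f) /\
  (forall x, has_partial i f x (partialC i f x)) /\ (p = 0%N -> partialC i f = fun _ => 0).
Proof.
move=> [c fE].
pose df x := \sum_(m : {ffun 'I_d -> 'I_p.+1} | (\sum_(i < d) (m i : nat) <= p)%N)
  c m * ((m i)%:R * mono (fun k => m k - (k == i))%N x).
have hf x : has_partial i f x (df x).
  rewrite (_ : f = fun x =>
   \sum_(m : {ffun 'I_d -> 'I_p.+1} | (\sum_(i < d) (m i : nat) <= p)%N)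
     c m * \prod_k toC (x 0 k) ^+ m k); last by apply/funext => y; rewrite fE.
  apply: has_partial_sum => m; apply: has_partialZ.
  have := has_partial_mono (fun k => (m k : nat)) (coord_is_derive i x).
  rewrite (bigD1 i)//= eqxx mulr1 [X in _ + X]big1 ?addr0// => k /negbTE ki.
  by rewrite ki mulr0 mul0r.
have -> : partialC i f = df by apply/funext => x; exact: has_partialE.
split; last first.
  split=> // p0; apply/funext => x; rewrite /df big1// => m.
  rewrite (bigD1 i)//= => mp; suff -> : (m i : nat) = 0%N by rewrite mul0r mulr0.
  by apply/eqP; rewrite -leqn0 -p0 (leq_trans _ mp) ?leq_addr.
apply: isPoly_sum => m mp; apply: isPolyZ.
case mi: (m i : nat) => [|k].
  by have := isPoly0 p.-1 d; congr isPoly; apply/funext => x; rewrite mul0r.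
apply/isPolyZ/isPoly_mono.
rewrite (bigD1 i)//= eqxx mi subn1 /= (eq_bigr (fun j => (m j : nat))).
  by move: mp; rewrite (bigD1 i)//= mi addSn; case: p {c fE df hf mi} m => // p m; rewrite ltnS.
by move=> j /negbTE ->; rewrite subn0.
Qed.
End Derivatives.
End PolynomialFunctions.

(** * Barycentric monomials on the reference simplex *)

Section ReferenceSimplex.
Variable R : realType.
Local Notation C := (complex R).
Implicit Types (p q n : nat).

Definition refInt n (h : 'rV[R]_n -> C) : C :=
  cSimplexInt n (fun xs => h (row_of_seq n xs)).

Definition bary n (x : 'rV[R]_n) : 'rV[R]_n.+1 :=
  \row_j (if unlift ord0 j is Some k then x 0 k else 1 - \sum_k x 0 k).

Lemma bary0 n (x : 'rV[R]_n) : bary x 0 ord0 = 1 - \sum_k x 0 k.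
Proof. by rewrite mxE unlift_none. Qed.

Lemma baryS n (x : 'rV[R]_n) k : bary x 0 (lift ord0 k) = x 0 k.
Proof. by rewrite mxE liftK. Qed.

Definition bary_weight n (a : 'I_n.+1 -> nat) : R :=
  (\prod_j (a j)`!)%N%:R / (n + \sum_j a j)`!%:R.

Definition tail_exponents n (a : 'I_n.+1 -> nat) : seq nat :=
  [seq a (lift ord0 i) | i <- enum 'I_n].

Lemma size_tail_exponents n (a : 'I_n.+1 -> nat) : size (tail_exponents a) = n.
Proof. by rewrite /tail_exponents size_map size_enum_ord. Qed.

Lemma mono_bary n (a : 'I_n.+1 -> nat) xs : size xs = n ->
  mono a (bary (row_of_seq n xs)) =
  toC (bmono (a ord0) (tail_exponents a) (1 : R) xs).
Proof.
move=> sx; rewrite (bmonoE _ _ (size_tail_exponents a) sx) toCM toCX toC_prod.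
rewrite /mono big_ord_recl bary0; congr (toC (_ - _) ^+ _ * _).
  by apply: eq_bigr => i _; rewrite mxE.
apply: eq_bigr => i _; rewrite baryS toCX mxE /tail_exponents (nth_map i) ?size_enum_ord//.
by rewrite nth_ord_enum.
Qed.

Lemma dirichlet_weight_tail n (a : 'I_n.+1 -> nat) :
  dirichlet_weight R (a ord0) (tail_exponents a) = bary_weight a.
Proof.
rewrite /dirichlet_weight /bary_weight /tail_exponents size_map size_enum_ord.
by rewrite sumnE 2!big_map 2!big_enum /= !big_ord_recl addnA.
Qed.

Lemma Re_sum_toC (T : Type) (l : seq T) (c : T -> C) (h : T -> R) :
  complex.Re (\sum_(k <- l) c k * toC (h k)) = \sum_(k <- l) complex.Re (c k) * h k.
Proof.
elim: l => [|k l IH]; rewrite ?big_nil// !big_cons -IH.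
by case: (c k) => a b; case: (\sum_(_ <- _) _) => u v /=; rewrite mulr0 subr0.
Qed.

Lemma Im_sum_toC (T : Type) (l : seq T) (c : T -> C) (h : T -> R) :
  complex.Im (\sum_(k <- l) c k * toC (h k)) = \sum_(k <- l) complex.Im (c k) * h k.
Proof.
elim: l => [|k l IH]; rewrite ?big_nil// !big_cons -IH.
by case: (c k) => a b; case: (\sum_(_ <- _) _) => u v /=; rewrite mulr0 add0r.
Qed.

(** Barycentric monomials are real-valued, so real and imaginary parts are real combinations of the
    same [bmono], and [simplexInt_bmono] applies to each. *)
Lemma refInt_bary n (T : Type) (l : seq T) (P : pred T) (c : T -> C)
    (a : T -> 'I_n.+1 -> nat) :
  refInt (fun x => \sum_(k <- l | P k) c k * mono (a k) (bary x)) =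
  \sum_(k <- l | P k) c k * toC (bary_weight (a k)).
Proof.
rewrite -[RHS]big_filter /refInt /cSimplexInt; set l' := [seq k <- l | P k].
have E xs : size xs = n ->
    \sum_(k <- l | P k) c k * mono (a k) (bary (row_of_seq n xs)) =
    \sum_(k <- l') c k * toC (bmono (a k ord0) (tail_exponents (a k)) (1 : R) xs).
  by move=> sx; rewrite -big_filter; apply: eq_bigr => k _; rewrite mono_bary.
have st k : size (tail_exponents (a k)) = n by exact: size_tail_exponents.
have I (g : T -> R) : simplexInt n 1 (fun xs => \sum_(k <- l')
     g k * bmono (a k ord0) (tail_exponents (a k)) 1 xs) =
     \sum_(k <- l') g k * bary_weight (a k).
  have [-> _] := simplexInt_bmono l' (fun k => a k ord0) g st ler01.
  by apply: eq_bigr => k _; rewrite expr1n mulr1 dirichlet_weight_tail.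
apply/eqP; rewrite eq_complex /= Re_sum_toC Im_sum_toC -!I; apply/andP; split; apply/eqP.
  by apply: simplexInt_ext => xs sx; rewrite E// Re_sum_toC.
by apply: simplexInt_ext => xs sx; rewrite E// Im_sum_toC.
Qed.

(** The coordinates of the reference simplex are its barycentric coordinates other than the one of
    index 0, so ordinary monomials are barycentric ones with exponent 0 there. *)
Definition extend0 n (a : 'I_n -> nat) (j : 'I_n.+1) : nat :=
  if unlift ord0 j is Some k then a k else 0%N.

Lemma mono_extend0 n (a : 'I_n -> nat) (x : 'rV[R]_n) :
  mono a x = mono (extend0 a) (bary x).
Proof.
rewrite [RHS]/mono big_ord_recl /extend0 unlift_none expr0 mul1r.
by apply: eq_bigr => i _; rewrite liftK baryS.
Qed.

Lemma refInt_poly n (T : Type) (l : seq T) (P : pred T) (c : T -> C)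
    (a : T -> 'I_n -> nat) :
  refInt (fun x => \sum_(k <- l | P k) c k * mono (a k) x) =
  \sum_(k <- l | P k) c k * toC (bary_weight (extend0 (a k))).
Proof.
rewrite -refInt_bary; congr refInt; apply/funext => x; apply: eq_bigr => k _.
by rewrite mono_extend0.
Qed.

(** Both sides are evaluated by [refInt_poly], which reduces the claim to an identity between
    coefficient sums. *)
Lemma refInt_lin p n (a : C) (f g : 'rV[R]_n -> C) : isPoly p f -> isPoly p g ->
  refInt (fun x => a * f x + g x) = a * refInt f + refInt g.
Proof.
move=> [c /funext ->] [c' /funext ->].
rewrite !(@refInt_poly _ _ (index_enum _) _ _ (fun (m : {ffun 'I_n -> 'I_p.+1}) i => m i)).
rewrite mulr_sumr -big_split /=.
rewrite (eq_bigr (fun m => (a * c m + c' m) *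
   toC (bary_weight (extend0 (fun i => (m i : nat)))))); last first.
  by move=> m _; rewrite mulrDl mulrA.
rewrite -refInt_poly; congr refInt; apply/funext => x.
rewrite mulr_sumr -big_split /=; apply: eq_bigr => m _.
by rewrite mulrDl mulrA.
Qed.

Lemma refInt_conj p n (f : 'rV[R]_n -> C) : isPoly p f ->
  refInt (fun x => conjc (f x)) = conjc (refInt f).
Proof.
move=> [c /funext ->].
rewrite (@refInt_poly _ _ (index_enum _) _ _ (fun (m : {ffun 'I_n -> 'I_p.+1}) i => m i)).
rewrite rmorph_sum (eq_bigr (fun m => conjc (c m) *
   toC (bary_weight (extend0 (fun i => (m i : nat)))))); last first.
  by move=> m _; rewrite rmorphM; congr (_ * _); exact: conjc_toC.
rewrite -refInt_poly; congr refInt; apply/funext => x.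
rewrite rmorph_sum; apply: eq_bigr => m _; rewrite rmorphM; congr (_ * _).
rewrite rmorph_prod; apply: eq_bigr => i _.
by rewrite rmorphXn; congr (_ ^+ _); exact: conjc_toC.
Qed.

Lemma refInt0 n : refInt (fun _ : 'rV[R]_n => 0) = 0.
Proof.
have := refInt_lin (-1) (isPoly0 R 0 n) (isPoly0 R 0 n).
by rewrite mulr0 addr0 mulN1r addNr.
Qed.

Lemma isPoly_line p n (f : 'rV[R]_n -> C) (x0 w : 'rV[R]_n) : isPoly p f ->
  exists P : {poly C}, forall s : R, P.[toC s] = f (x0 + s *: w).
Proof.
move=> [c fE].
exists (\sum_(m : {ffun 'I_n -> 'I_p.+1} | (\sum_(i < n) (m i : nat) <= p)%N)
   c m *: \prod_(i < n) ((toC (x0 0 i))%:P + toC (w 0 i) *: 'X) ^+ m i) => s.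
rewrite fE horner_sum; apply: eq_bigr => m _; rewrite hornerZ horner_prod.
congr (_ * _); apply: eq_bigr => i _; rewrite horner_exp hornerD hornerC hornerZ hornerX.
by rewrite !mxE toCD toCM [toC s * _]mulrC.
Qed.

(** On the line from an interior point [x0] to any [x], the restriction of [f] is a univariate
    polynomial with infinitely many zeros near [x0]; its value at parameter 1 is [f x]. *)
Lemma isPoly_eq0_simplex p n (f : 'rV[R]_n -> C) : isPoly p f ->
  (forall x : 'rV[R]_n, (forall i, 0 < x 0 i) -> \sum_i x 0 i < 1 -> f x = 0) ->
  f = fun _ => 0.
Proof.
move=> pf f0; apply/funext => x.
pose e : R := n.+1%:R^-1; have e0 : 0 < e by rewrite invr_gt0.
pose x0 : 'rV[R]_n := const_mx e.
(* All coordinates of [x0] equal [e], and so does the slack [1 - n * e]; a step [s] with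
   [s * D <= e] therefore stays in the open simplex. The summand 1 keeps [D] positive and the
   inequality strict. *)
pose D : R := 1 + \sum_i `|(x - x0) 0 i|.
have D0 : 0 < D by rewrite ltr_pwDl// sumr_ge0.
have [P PE] := isPoly_line x0 (x - x0) pf.
suff P0 : P = 0.
  have := PE 1; rewrite P0 horner0 scale1r addrC subrK => <- //.
pose s k : R := e / D / k.+1%:R.
have s0 k : 0 < s k by rewrite !divr_gt0.
apply: (@poly_eq0_of_inj_roots _ _ (fun k => toC (s k))).
  move=> j k [] /(mulfI (lt0r_neq0 (divr_gt0 e0 D0))) /invr_inj /eqP.
  by rewrite eqr_nat => /eqP[].
move=> k; rewrite PE.
have sD : s k * D <= e.
  by rewrite /s mulrAC divfK ?gt_eqF// ler_pdivrMr// ler_pMr// ler1n.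
have sS : s k * \sum_i `|(x - x0) 0 i| < e.
  by apply: lt_le_trans sD; rewrite ltr_pM2l// ltrDr.
apply: f0 => [i|].
  have : s k * `|(x - x0) 0 i| < e.
    apply: le_lt_trans sS; rewrite ler_pM2l// (bigD1 i)//= lerDl sumr_ge0//.
  have := ler_norm (- ((x - x0) 0 i)); rewrite normrN => wn swe.
  have -> : (x0 + s k *: (x - x0)) 0 i = e + s k * (x - x0) 0 i by rewrite !mxE.
  rewrite -[s k * _]opprK subr_gt0 -mulrN; apply: le_lt_trans swe.
  by rewrite ler_pM2l.
rewrite (eq_bigr (fun i => e + s k * (x - x0) 0 i)) => [|i _]; last by rewrite !mxE.
have ne : n%:R * e + e = 1 by rewrite -[X in _ + X]mul1r -mulrDl natr1 divff.
rewrite big_split /= sumr_const card_ord -mulr_natl -mulr_sumr -[X in _ < X]ne ltrD2l.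
apply: le_lt_trans sS; rewrite ler_pM2l//; apply: ler_sum => i _; exact: ler_norm.
Qed.

(** The integrand has real part [|f|^2], a nonnegative polynomial, to which [simplexInt_eq0] applies
    on the open simplex. *)
Lemma refInt_norm_eq0 p n (f : 'rV[R]_n -> C) : isPoly p f ->
  refInt (fun x => f x * conjc (f x)) = 0 -> f = fun _ => 0.
Proof.
move=> pf I0; apply: (isPoly_eq0_simplex pf) => x x0 x1.
have [c ffE] := isPolyM pf (isPoly_conj pf).
have Re_norm (z : C) : complex.Re (z * conjc z) = complex.Re z ^+ 2 + complex.Im z ^+ 2.
  by case: z => u v /=; rewrite mulrN opprK -!expr2.
pose l := [seq m : {ffun 'I_n -> 'I_(p + p).+1} <- index_enum {ffun 'I_n -> 'I_(p + p).+1} |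
             (\sum_(i < n) (m i : nat) <= p + p)%N].
pose a (m : {ffun 'I_n -> 'I_(p + p).+1}) := tail_exponents (extend0 (fun i => (m i : nat))).
pose g xs : R := \sum_(m <- l) complex.Re (c m) * bmono 0 (a m) 1 xs.
have sa m : size (a m) = n by exact: size_tail_exponents.
have gE xs : size xs = n ->
    complex.Re (f (row_of_seq n xs) * conjc (f (row_of_seq n xs))) = g xs.
  move=> sx; rewrite ffE -big_filter -/l /g -Re_sum_toC; congr complex.Re.
  apply: eq_bigr => m _; congr (_ * _).
  have := mono_extend0 (fun i => (m i : nat)) (row_of_seq n xs).
  by rewrite mono_bary// /extend0 unlift_none.
have g_ge0 xs : size xs = n -> in_simplex false 1 xs -> 0 <= g xs.
  by move=> sx _; rewrite -gE// Re_norm addr_ge0 ?sqr_ge0.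
have Ig : simplexInt n 1 g = 0.
  move: I0 => [+ _]; apply: etrans; apply: simplexInt_ext => xs sx.
  by rewrite gE.
pose xs := [seq x 0 i | i <- enum 'I_n].
have sx : size xs = n by rewrite size_map size_enum_ord.
have xE : row_of_seq n xs = x.
  apply/rowP => i; rewrite mxE (nth_map i) ?size_enum_ord//; by rewrite nth_ord_enum.
have := @simplexInt_eq0 R _ l (fun _ => 0%N) n (fun m => complex.Re (c m)) a 1 xs sa ltr01
  g_ge0 Ig sx.
have -> : in_simplex true 1 xs.
  apply/andP; split; last by rewrite big_map big_enum.
  by apply/allP => _ /mapP[i _ ->].
move=> /(_ isT); rewrite -/(g xs) -gE// xE Re_norm => /eqP.
rewrite paddr_eq0 ?sqr_ge0// !sqrf_eq0 => fx0; apply/eqP; rewrite eq_complex; exact: fx0.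
Qed.
End ReferenceSimplex.

(** * Barycentric coordinates of a simplex and its faces *)

Section Geometry.
Variables (R : realType).
Local Notation C := (complex R).

(** The filtered list and the image of [bump j] are both strictly increasing with the same members,
    hence equal. *)
Lemma faceVertE d (v : nat -> 'rV[R]_d) j k : (j < d.+1)%N -> (k < d)%N ->
  faceVert v j k = v (bump j k).
Proof.
move=> jd kd; rewrite /faceVert.
have -> : [seq i <- iota 0 d.+1 | i != j] = [seq bump j i | i <- iota 0 d].
  apply: (@irr_sorted_eq _ ltn ltn_trans ltnn).
  - by apply: sorted_filter; [exact: ltn_trans | exact: iota_ltn_sorted].
  - rewrite sorted_map; apply: sub_sorted (iota_ltn_sorted 0 d) => x y /=.
    by rewrite /bump => xy; case: (leqP j x) => jx; case: (leqP j y) => jy;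
      rewrite ?add1n ?add0n ?ltnS//;
      [have := leq_trans jx (ltnW xy); rewrite leqNgt jy | exact: ltnW].
  - move=> x; rewrite mem_filter mem_iota add0n /=; apply/andP/mapP.
      move=> [xj xd]; exists (unbump j x); last by rewrite unbumpK// inE.
      rewrite mem_iota add0n /= /unbump; case: (ltngtP j x) xj => // [jx|xj] _.
        by rewrite subn1 -ltnS prednK// (leq_ltn_trans _ jx).
      by rewrite subn0 (leq_trans xj).
    move=> [y]; rewrite mem_iota add0n /= => yd ->; split; first by rewrite eq_sym neq_bump.
    by rewrite /bump; case: (j <= y)%N; rewrite ?add1n ?add0n ltnS// ltnW.
by rewrite -map_comp (nth_map 0%N) ?size_iota// nth_iota.
Qed.

Section Vertices.
Variable d : nat.
Implicit Types (v : nat -> 'rV[R]_d) (x : 'rV[R]_d).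

(** Homogeneous coordinates turn affine combinations into linear ones, so barycentric coordinates
    solve a linear system with matrix [vertexmx]. *)
Definition homog x : 'rV[R]_d.+1 :=
  \row_l (if unlift ord0 l is Some i then x 0 i else 1).

Definition vertexmx v : 'M[R]_d.+1 := \matrix_k homog (v k).

Lemma det_vertexmx v : \det (vertexmx v) = \det (jacK v).
Proof.
(* Subtracting the row of vertex 0 from the others, as a block LU factorization. *)
pose L : 'M[R]_(1 + d) := block_mx 1%:M 0 (const_mx 1) 1%:M.
pose U : 'M[R]_(1 + d) := block_mx 1%:M (v 0%N) 0 (jacK v).
have -> : vertexmx v = L *m U.
  rewrite /L /U mulmx_block !mul1mx !mul0mx !mulmx1 ?addr0 ?mulmx0 ?addr0.
  apply/matrixP => k l; rewrite !mxE.
  case: splitP => k' k'E; rewrite !mxE; case: splitP => l' l'E.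
  - rewrite (_ : l = ord0) ?unlift_none; last by apply/val_inj; rewrite /= l'E (ord1 l').
    by rewrite !mxE (ord1 k') (ord1 l') eqxx.
  - rewrite (_ : l = lift ord0 l') ?liftK; last exact/val_inj.
    by rewrite k'E (ord1 k') (_ : 0 = ord0)//; congr (v _ _ _).
  - rewrite (_ : l = ord0) ?unlift_none; last by apply/val_inj; rewrite /= l'E (ord1 l').
    by rewrite !mxE.
  - rewrite (_ : l = lift ord0 l') ?liftK; last exact/val_inj.
    rewrite !mxE big_ord1 !mxE mul1r k'E add1n addrC subrK.
    by [].
transitivity (\det L * \det U); first exact: det_mulmx.
by rewrite /L /U det_lblock det_ublock !det1 !mul1r.
Qed.

Variable v : nat -> 'rV[R]_d.
Hypothesis hK : \det (jacK v) != 0.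

Lemma vertexmx_unit : vertexmx v \in unitmx.
Proof. by rewrite unitmxE unitfE det_vertexmx. Qed.

Definition lam x : 'rV[R]_d.+1 := homog x *m invmx (vertexmx v).

Definition lam_grad (j : 'I_d.+1) (i : 'I_d) : R := invmx (vertexmx v) (lift ord0 i) j.

Lemma lam_affine x j : lam x 0 j =
  invmx (vertexmx v) ord0 j + \sum_i x 0 i * lam_grad j i.
Proof.
rewrite mxE big_ord_recl mxE unlift_none mul1r; congr (_ + _).
by apply: eq_bigr => i _; rewrite mxE liftK.
Qed.

Lemma vertex_combE (y : 'rV[R]_d.+1) : \sum_k y 0 k = 1 ->
  homog (\sum_k y 0 k *: v k) = y *m vertexmx v.
Proof.
move=> y1; apply/rowP => l; rewrite !mxE; case: unliftP => [i ->|->].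
  by rewrite summxE; apply: eq_bigr => k _; rewrite !mxE liftK.
by rewrite -[LHS]y1; apply: eq_bigr => k _; rewrite !mxE unlift_none mulr1.
Qed.

Lemma lam_comb (y : 'rV[R]_d.+1) : \sum_k y 0 k = 1 -> lam (\sum_k y 0 k *: v k) = y.
Proof. by move=> y1; rewrite /lam vertex_combE// mulmxK ?vertexmx_unit. Qed.

Lemma lamK x : \sum_k lam x 0 k *: v k = x.
Proof.
have E : lam x *m vertexmx v = homog x by rewrite /lam mulmxKV ?vertexmx_unit.
apply/rowP => i; have := congr1 (fun A : 'rV[R]_d.+1 => A 0 (lift ord0 i)) E.
rewrite !mxE liftK summxE => <-; apply: eq_bigr => k _.
by rewrite [in LHS]mxE [vertexmx _ _ _]mxE [homog _ _ _]mxE liftK.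
Qed.

(** The barycentric coordinates sum to 1: column 0 of [vertexmx] consists of ones, and the identity
    is an off-diagonal entry of inverse times matrix. *)
Lemma lam_grad_sum i : \sum_j lam_grad j i = 0.
Proof.
have := congr1 (fun A : 'M[R]_d.+1 => A (lift ord0 i) ord0) (mulVmx vertexmx_unit).
rewrite !mxE [LHS](eq_bigr (fun j => lam_grad j i)) => [->|j _]; first by [].
by rewrite !mxE unlift_none mulr1.
Qed.

Lemma lam_vertex (k j : 'I_d.+1) : lam (v k) 0 j = (k == j)%:R.
Proof.
pose y : 'rV[R]_d.+1 := delta_mx 0 k.
have y1 : \sum_l y 0 l = 1.
  rewrite (bigD1 k)//= mxE !eqxx big1 ?addr0// => l /negbTE lk.
  by rewrite mxE lk andbF.
have yv : \sum_l y 0 l *: v l = v k.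
  rewrite (bigD1 k)//= mxE !eqxx scale1r big1 ?addr0// => l /negbTE lk.
  by rewrite mxE lk andbF scale0r.
by have := lam_comb y1; rewrite yv => ->; rewrite mxE eqxx /= eq_sym.
Qed.

Lemma mapK_bary t : Defs.mapK v t = \sum_k bary t 0 k *: v k.
Proof.
rewrite /Defs.mapK [RHS]big_ord_recl bary0 scalerBl scale1r -addrA; congr (_ + _).
rewrite addrC scaler_suml -sumrB; apply: eq_bigr => i _.
by rewrite baryS scalerBr.
Qed.

Lemma bary_sum n (t : 'rV[R]_n) : \sum_k bary t 0 k = 1.
Proof.
rewrite big_ord_recl bary0 [X in _ + X](eq_bigr (fun k => t 0 k)) ?subrK// => k _.
by rewrite baryS.
Qed.

Lemma lam_mapK t : lam (Defs.mapK v t) = bary t.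
Proof. by rewrite mapK_bary lam_comb ?bary_sum. Qed.
End Vertices.

(** * Faces of the simplex and their outward normals *)

Section Faces.
Variable m : nat.
Local Notation d := m.+1.
Variables (v : nat -> 'rV[R]_d) (j : 'I_d.+1).

(** Turns barycentric coordinates on the face opposite to vertex [i] into those on the whole
    simplex, where the coordinate of index [i] vanishes. *)
Definition insert0 n (i : 'I_n.+1) (y : 'rV[R]_n) : 'rV[R]_n.+1 :=
  \row_k (if unlift i k is Some l then y 0 l else 0).

Lemma mapF_bary s : mapF v j s = \sum_k insert0 j (bary s) 0 k *: v k.
Proof.
transitivity (\sum_(k < d) bary s 0 k *: v (lift j k)).
  rewrite /mapF [RHS]big_ord_recl bary0 scalerBl scale1r -addrA.
  rewrite faceVertE//; congr (_ + _).
  rewrite addrC scaler_suml -sumrB; apply: eq_bigr => i _.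
  by rewrite baryS scalerBr faceVertE//= ltnS.
rewrite [RHS](bigD1_ord j)//= mxE unlift_none scale0r add0r.
by apply: eq_bigr => k _; rewrite [insert0 _ _ _ _]mxE liftK.
Qed.

Lemma lam_mapF s : \det (jacK v) != 0 -> lam v (mapF v j s) = insert0 j (bary s).
Proof.
move=> hK; rewrite mapF_bary lam_comb//.
rewrite (bigD1_ord j)//= mxE unlift_none add0r -[RHS](bary_sum s).
by apply: eq_bigr => k _; rewrite [insert0 _ _ _ _]mxE liftK.
Qed.

(** Puts the base point of [mapF] first and the opposite vertex second: the first row of the
    Jacobian is then a transversal edge and the others span the face. *)
Definition face_first (k : nat) : 'rV[R]_d :=
  match k with 0%N => v (bump j 0) | 1%N => v j | k'.+2 => v (bump j k'.+1) end.

Lemma det_face_first : `|\det (jacK face_first)| = `|\det (jacK v)|.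
Proof.
(* [lift_perm] moves vertex [j] to the front; the transposition then makes it second. *)
pose s : {perm 'I_d.+1} := (tperm ord0 (lift ord0 ord0) * lift_perm ord0 j 1)%g.
rewrite -!det_vertexmx.
have -> : vertexmx face_first = row_perm s (vertexmx v).
  apply/matrixP => k l; rewrite !mxE; congr (if unlift ord0 l is Some i then _ else _).
  rewrite /s permM.
  case: (unliftP ord0 k) => [k' ->|->]; last by rewrite tpermL lift_perm_lift perm1.
  case: (unliftP ord0 k') => [k'' ->|->]; last by rewrite tpermR lift_perm_id.
  by rewrite tpermD// lift_perm_lift perm1.
by rewrite row_permE det_mulmx det_perm normrM normrX normrN1 expr1n mul1r.
Qed.

Hypothesis hK : \det (jacK v) != 0.

(** Both [n] and the gradient of [lambda_j] are orthogonal to the face, hence proportional; the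
    factor is fixed by the relation volume equals height times base, which holds here for the
    Jacobians. *)
Lemma normal_lam_grad (n : 'rV[R]_d) (i : 'I_d) : outward_unit_normal v j n ->
  Num.sqrt (\det (gramF v j)) * n 0 i = - (`|\det (jacK v)| * lam_grad v j i).
Proof.
move=> [n_orth [n_unit n_out]].
pose E := jacK face_first; pose dE := \det E.
have dE0 : dE != 0 by rewrite -normr_eq0 det_face_first normr_eq0.
have Eu : E \in unitmx by rewrite unitmxE unitfE.
pose g : 'rV[R]_d := \row_k lam_grad v j k.
have dotE (u w : 'rV[R]_d) : (u *m w^T) 0 0 = dotR u w.
  by rewrite mxE; apply: eq_bigr => k _; rewrite mxE.
have f0E : faceVert v j 0 = v (lift j ord0) by rewrite faceVertE.
have fSE (k : 'I_m) : faceVert v j k.+1 = v (lift j (lift ord0 k)).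
  by rewrite faceVertE//= ltnS.
have gdot (a b : 'I_d.+1) : dotR g (v a - v b) = (a == j)%:R - (b == j)%:R.
  rewrite -!(lam_vertex hK) !lam_affine opprD addrACA subrr add0r -sumrB.
  by apply: eq_bigr => k _; rewrite !mxE; ring.
have E0 : row ord0 E = v j - faceVert v j 0.
  by rewrite f0E; apply/rowP => k; rewrite !mxE.
have ES (k : 'I_m) : row (lift ord0 k) E = faceVert v j k.+1 - faceVert v j 0.
  by rewrite f0E fSE; apply/rowP => l; rewrite !mxE.
have En (u : 'rV[R]_d) k : (u *m E^T) 0 k = dotR u (row k E).
  by rewrite mxE; apply: eq_bigr => l _; rewrite !mxE.
(* Minus the height of vertex [j] over the face. *)
pose c := dotR n (v j - faceVert v j 0).
have nE : n = c *: g.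
  apply: (can_inj (mulmxK (_ : E^T \in unitmx))); first by rewrite unitmx_tr.
  apply/rowP => k; rewrite -scalemxAl [RHS]mxE !En.
  case: (unliftP ord0 k) => [l ->|->].
    by rewrite ES n_orth// f0E fSE gdot !(eq_sym _ j) !(negbTE (neq_lift _ _)) subrr mulr0.
  by rewrite E0 -/c f0E gdot eqxx eq_sym (negbTE (neq_lift _ _)) subr0 mulr1.
(* Coordinates of [n] in the edge basis. Only the transversal edge contributes to [n . n = 1],
   whence [a_0 * c = 1]. *)
pose a := n *m invmx E.
have aE : a *m E = n by rewrite mulmxKV.
have a0c : a 0 ord0 * c = 1.
  rewrite -[RHS]n_unit -dotE -{1}aE -mulmxA [RHS]mxE big_ord_recl big1 ?addr0 => [|k _].
    congr (a _ _ * _); rewrite mxE /c -E0; apply: eq_bigr => l _.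
    by rewrite !mxE mulrC.
  apply/eqP; rewrite mulf_eq0; apply/orP; right; apply/eqP.
  have := n_orth k (ltn_ord k); rewrite -ES => <-.
  by rewrite mxE; apply: eq_bigr => l _; rewrite !mxE mulrC.
pose D : 'M[R]_(m, d) := \matrix_k (faceVert v j k.+1 - faceVert v j 0).
pose M : 'M[R]_(1 + m, d) := col_mx n D.
have E_col : E = col_mx (v j - faceVert v j 0) D :> 'M[R]_(1 + m, d).
  apply/row_matrixP => k; case: (unliftP ord0 k) => [l ->|->].
    by rewrite ES (_ : lift ord0 l = rshift 1 l) ?rowKd ?rowK//; exact/val_inj.
  by rewrite E0 (_ : @ord0 m = lshift m (@ord0 0)) ?rowKu ?row_id//; exact/val_inj.
(* Replacing the transversal edge by [n] is a block triangular change of rows, of determinant [a_0].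
   The Gram matrix of the new rows is block diagonal because [n] is a unit normal. *)
pose T : 'M[R]_(1 + m) := block_mx (a 0 ord0)%:M (rsubmx (a : 'rV[R]_(1 + m))) 0 1%:M.
have nE2 : (a 0 ord0)%:M *m (v j - faceVert v j 0) +
    rsubmx (a : 'rV[R]_(1 + m)) *m D = n.
  rewrite -[RHS]aE E_col.
  transitivity (row_mx (lsubmx (a : 'rV[R]_(1 + m))) (rsubmx (a : 'rV[R]_(1 + m))) *m
     col_mx (v j - faceVert v j 0) D); last by rewrite hsubmxK.
  rewrite mul_row_col; congr (_ *m _ + _).
  by rewrite [RHS]mx11_scalar [lsubmx _ _ _]mxE (_ : lshift m 0 = ord0)//; exact/val_inj.
have ME : M = T *m E.
  by rewrite E_col /T mul_block_col mul0mx mul1mx add0r nE2.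
have MM : M *m M^T = block_mx 1%:M 0 0 (gramF v j) :> 'M[R]_(1 + m).
  have nD : n *m D^T = 0.
    apply/rowP => k; rewrite !mxE -[RHS](n_orth k (ltn_ord k)).
    by apply: eq_bigr => l _; rewrite !mxE.
  rewrite /M tr_col_mx mul_col_row nD -[D *m n^T]trmxK trmx_mul trmxK nD trmx0.
  congr block_mx; first by rewrite [LHS]mx11_scalar dotE n_unit.
  by apply/matrixP => k l; rewrite !mxE; apply: eq_bigr => r _; rewrite !mxE.
have gramE : \det (gramF v j) = (a 0 ord0 * dE) ^+ 2.
  have := congr1 determinant MM; rewrite det_ublock det1 mul1r => <-.
  transitivity (\det (M : 'M[R]_d) * \det (M^T : 'M[R]_d)); first exact: det_mulmx.
  rewrite det_tr -expr2; congr (_ ^+ 2); rewrite ME.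
  transitivity (\det T * dE); first exact: det_mulmx.
  by rewrite /T det_ublock det1 mulr1 det_scalar1.
have c0 : c < 0 by [].
have a00 : a 0 ord0 < 0 by rewrite -(nmulr_lgt0 _ c0) a0c ltr01.
have ni : n 0 i = c * lam_grad v j i by rewrite {1}nE !mxE.
rewrite gramE sqrtr_sqr normrM det_face_first ni ltr0_norm//.
transitivity (- (a 0 ord0 * c * (`|\det (jacK v)| * lam_grad v j i))); last first.
  by rewrite a0c mul1r.
by move: (a 0 ord0) (lam_grad _ _ _) `|_| (c) => x y z w; ring.
Qed.
End Faces.
End Geometry.

(** * Inner products and the divergence theorem *)

Section InnerProducts.
Variable R : realType.
Local Notation C := (complex R).

Definition refIp n (f g : 'rV[R]_n -> C) := refInt (fun x => f x * conjc (g x)).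

Lemma refIp_lin p n (a : C) (f1 f2 g : 'rV[R]_n -> C) :
  isPoly p f1 -> isPoly p f2 -> isPoly p g ->
  refIp (fun x => a * f1 x + f2 x) g = a * refIp f1 g + refIp f2 g.
Proof.
move=> p1 p2 /isPoly_conj pg; rewrite /refIp -(refInt_lin a (isPolyM p1 pg) (isPolyM p2 pg)).
by congr refInt; apply/funext => x; rewrite mulrDl mulrA.
Qed.

Lemma refIp_conj p n (f g : 'rV[R]_n -> C) : isPoly p f -> isPoly p g ->
  conjc (refIp f g) = refIp g f.
Proof.
move=> pf /isPoly_conj pg; rewrite /refIp -(refInt_conj (isPolyM pf pg)).
by congr refInt; apply/funext => x; rewrite conjcM conjcK mulrC.
Qed.

Section Simplex.
Variable d : nat.
Variable v : nat -> 'rV[R]_d.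
Implicit Types (f g : 'rV[R]_d -> C).

Lemma isPoly_mapK p f : isPoly p f -> isPoly p (fun t => f (Defs.mapK v t)).
Proof.
apply: isPoly_comp => i.
have := isPoly_affine (v 0%N 0 i) (fun k : 'I_d => (v k.+1 - v 0%N) 0 i).
congr isPoly; apply/funext => t; rewrite /Defs.mapK !mxE summxE; congr (toC (_ + _)).
by apply: eq_bigr => k _; rewrite [RHS]mxE.
Qed.

Lemma isPoly_traceF p j f : isPoly p f -> isPoly p (traceF v j f).
Proof.
apply: isPoly_comp => i.
have := isPoly_affine (faceVert v j 0 0 i)
  (fun k : 'I_d.-1 => (faceVert v j k.+1 - faceVert v j 0) 0 i).
congr isPoly; apply/funext => t; rewrite /mapF !mxE summxE; congr (toC (_ + _)).
by apply: eq_bigr => k _; rewrite [RHS]mxE.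
Qed.

Lemma ipKE f g : ipK v f g = toC `|\det (jacK v)| *
  refIp (fun t => f (Defs.mapK v t)) (fun t => g (Defs.mapK v t)).
Proof. by []. Qed.

Lemma ipFE j (f g : 'rV[R]_d.-1 -> C) :
  ipF v j f g = toC (Num.sqrt (\det (gramF v j))) * refIp f g.
Proof. by []. Qed.

Lemma ipK_lin p (a : C) f1 f2 g : isPoly p f1 -> isPoly p f2 -> isPoly p g ->
  ipK v (fun x => a * f1 x + f2 x) g = a * ipK v f1 g + ipK v f2 g.
Proof.
move=> /isPoly_mapK p1 /isPoly_mapK p2 /isPoly_mapK pg.
by rewrite !ipKE (refIp_lin a p1 p2 pg) mulrDr mulrCA.
Qed.

Lemma ipF_lin p j (a : C) (f1 f2 g : 'rV[R]_d.-1 -> C) :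
  isPoly p f1 -> isPoly p f2 -> isPoly p g ->
  ipF v j (fun x => a * f1 x + f2 x) g = a * ipF v j f1 g + ipF v j f2 g.
Proof. by move=> p1 p2 pg; rewrite !ipFE (refIp_lin a p1 p2 pg) mulrDr mulrCA. Qed.

Lemma ipK_conj p f g : isPoly p f -> isPoly p g -> conjc (ipK v f g) = ipK v g f.
Proof.
move=> /isPoly_mapK pf /isPoly_mapK pg; rewrite !ipKE conjcM conjc_toC.
by rewrite (refIp_conj pf pg).
Qed.

Lemma ipF_conj p j (f g : 'rV[R]_d.-1 -> C) : isPoly p f -> isPoly p g ->
  conjc (ipF v j f g) = ipF v j g f.
Proof. by move=> pf pg; rewrite !ipFE conjcM conjc_toC (refIp_conj pf pg). Qed.

Lemma ipK0l g : ipK v (fun _ => 0) g = 0.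
Proof. by rewrite ipKE /refIp; under eq_fun do rewrite mul0r; rewrite refInt0 mulr0. Qed.

Lemma ipF0l j (g : 'rV[R]_d.-1 -> C) : ipF v j (fun _ => 0) g = 0.
Proof. by rewrite ipFE /refIp; under eq_fun do rewrite mul0r; rewrite refInt0 mulr0. Qed.

Lemma ipK_linr p (a : C) f g1 g2 : isPoly p f -> isPoly p g1 -> isPoly p g2 ->
  ipK v f (fun x => a * g1 x + g2 x) = conjc a * ipK v f g1 + ipK v f g2.
Proof.
move=> pf p1 p2; rewrite -(ipK_conj (isPoly_lin a p1 p2) pf) (ipK_lin a p1 p2 pf).
by rewrite conjcD conjcM !(@ipK_conj p).
Qed.

Lemma ipF_linr p j (a : C) (f g1 g2 : 'rV[R]_d.-1 -> C) :
  isPoly p f -> isPoly p g1 -> isPoly p g2 ->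
  ipF v j f (fun x => a * g1 x + g2 x) = conjc a * ipF v j f g1 + ipF v j f g2.
Proof.
move=> pf p1 p2; rewrite -(ipF_conj j (isPoly_lin a p1 p2) pf) (ipF_lin j a p1 p2 pf).
by rewrite conjcD conjcM !(@ipF_conj p).
Qed.

Lemma ipK0r f : ipK v f (fun _ => 0) = 0.
Proof. by rewrite ipKE /refIp; under eq_fun do rewrite conjc0 mulr0; rewrite refInt0 mulr0. Qed.

Lemma ipF0r j (f : 'rV[R]_d.-1 -> C) : ipF v j f (fun _ => 0) = 0.
Proof. by rewrite ipFE /refIp; under eq_fun do rewrite conjc0 mulr0; rewrite refInt0 mulr0. Qed.

Lemma ipK_suml p (I : Type) (r : seq I) (c : I -> C) (F : I -> 'rV[R]_d -> C) g :
  (forall i, isPoly p (F i)) -> isPoly p g ->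
  ipK v (fun x => \sum_(i <- r) c i * F i x) g = \sum_(i <- r) c i * ipK v (F i) g.
Proof.
move=> pF pg; elim: r => [|i r IH].
  by under eq_fun do rewrite big_nil; rewrite ipK0l big_nil.
under eq_fun do rewrite big_cons; rewrite big_cons -IH.
by apply: (@ipK_lin p) => //; apply: isPoly_sum => k _; exact: isPolyZ.
Qed.

Lemma ipF_suml p j (I : Type) (r : seq I) (c : I -> C)
    (F : I -> 'rV[R]_d.-1 -> C) (g : 'rV[R]_d.-1 -> C) :
  (forall i, isPoly p (F i)) -> isPoly p g ->
  ipF v j (fun x => \sum_(i <- r) c i * F i x) g = \sum_(i <- r) c i * ipF v j (F i) g.
Proof.
move=> pF pg; elim: r => [|i r IH].
  by under eq_fun do rewrite big_nil; rewrite ipF0l big_nil.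
under eq_fun do rewrite big_cons; rewrite big_cons -IH.
by apply: (@ipF_lin p) => //; apply: isPoly_sum => k _; exact: isPolyZ.
Qed.

Hypothesis hK : \det (jacK v) != 0.

Lemma mapK_surj x : exists t, Defs.mapK v t = x.
Proof.
exists ((x - v 0%N) *m invmx (jacK v)); rewrite /Defs.mapK.
have E : (x - v 0%N) *m invmx (jacK v) *m jacK v = x - v 0%N.
  by rewrite mulmxKV// unitmxE unitfE.
apply: (addrI (- v 0%N)); rewrite addKr [RHS]addrC -[RHS]E [RHS]mulmx_sum_row.
by apply: eq_bigr => i _; congr (_ *: _); apply/rowP => k; rewrite !mxE.
Qed.

(** [refInt_norm_eq0] gives vanishing at every parameter, not only in the reference simplex, and
    [mapK] is onto the whole space. *)
Lemma ipK_eq0 p f : isPoly p f -> ipK v f f = 0 -> f = fun _ => 0.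
Proof.
move=> /isPoly_mapK pf /eqP; rewrite ipKE mulf_eq0 toC_eq0 normr_eq0 (negbTE hK) /=.
move=> /eqP /(refInt_norm_eq0 pf) f0; apply/funext => x.
by have [t <-] := mapK_surj x; exact: (congr1 (@^~ t) f0).
Qed.
End Simplex.

Section Divergence.
Variable m : nat.
Local Notation d := m.+1.
Variable v : nat -> 'rV[R]_d.
Hypothesis hK : \det (jacK v) != 0.
Variable n : nat -> 'rV[R]_d.
Hypothesis hn : forall j, (j < d.+1)%N -> outward_unit_normal v j (n j).
Implicit Types (f g h : 'rV[R]_d -> C).

Lemma mono_insert0 k (j : 'I_k.+1) (a : 'I_k.+1 -> nat) (y : 'rV[R]_k) :
  mono a (insert0 j y) = (a j == 0)%:R * mono (fun l => a (lift j l)) y.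
Proof.
rewrite /mono (bigD1_ord j)//= mxE unlift_none toC0 expr0n; congr (_ * _).
by apply: eq_bigr => l _; rewrite mxE liftK.
Qed.

(* Integrating a derivative lowers one exponent of a barycentric monomial, and
   the face opposite to vertex [j] only sees monomials free of [lambda_j]; both
   contribute the same Dirichlet constant. *)
Lemma bary_weight_face (a : 'I_d.+1 -> nat) (j : 'I_d.+1) :
  (a j)%:R * bary_weight R (fun k => a k - (k == j))%N +
  (a j == 0%N)%:R * bary_weight R (fun l => a (lift j l)) =
  (\prod_k (a k)`!)%N%:R / (m + \sum_k a k)`!%:R.
Proof.
rewrite /bary_weight.
rewrite [(\sum_k a k)%N](bigD1_ord j)//= [(\sum_k (_ - _))%N](bigD1_ord j)//=.
rewrite [(\prod_k (a k)`!)%N](bigD1_ord j)//= [(\prod_k (_ - _)`!)%N](bigD1_ord j)//=.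
rewrite eqxx subn1.
rewrite (eq_bigr (fun l => (a (lift j l))`!)) => [|l _]; last first.
  by rewrite eq_sym (negbTE (neq_lift _ _)) subn0.
rewrite [(\sum_l (a (lift j l) - _))%N](eq_bigr (fun l => a (lift j l))) => [|l _]; last first.
  by rewrite eq_sym (negbTE (neq_lift _ _)) subn0.
case: (a j) => [|b] /=; first by rewrite mul0r add0r mul1r fact0 mul1n add0n.
rewrite mul0r addr0 factS -mulnA [in RHS]natrM -mulrA; congr (_ * (_ / _`!%:R)).
by rewrite addSn !addnS.
Qed.

(** With [h] written in barycentric coordinates, both sides become sums of Dirichlet constants times
    gradients of the [lambda_j]. By [bary_weight_face] their difference is, for each monomial, one
    constant times the sum of all these gradients, which is zero. *)
Lemma divergence p i h : isPoly p h ->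
  toC `|\det (jacK v)| * refInt (fun t => partialC i h (Defs.mapK v t)) =
  \sum_(j < d.+1) toC (Num.sqrt (\det (gramF v j)) * n j 0 i) * refInt (traceF v j h).
Proof.
move=> ph.
pose F (y : 'rV[R]_d.+1) := h (\sum_k y 0 k *: v k).
have [c FE] : isPoly p F.
  apply: isPoly_comp ph => l.
  have := isPoly_affine 0 (fun k : 'I_d.+1 => v k 0 l).
  congr isPoly; apply/funext => y; rewrite summxE add0r; congr toC.
  by apply: eq_bigr => k _; rewrite [RHS]mxE.
pose S := [pred a : {ffun 'I_d.+1 -> 'I_p.+1} | (\sum_k (a k : nat) <= p)%N].
have hE x : h x = \sum_(a | S a) c a * mono (fun k => a k) (lam v x).
  by rewrite -[in LHS](lamK hK x) -/(F _) FE.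
have dlam x k : is_derive x (unitvec R i) (fun y => lam v y 0 k) (lam_grad v k i).
  have := is_derive_affine x (unitvec R i) (invmx (vertexmx v) ord0 k) (lam_grad v k).
  under eq_fun do rewrite -lam_affine.
  congr is_derive; rewrite (bigD1 i)//= mxE eqxx mul1r big1 ?addr0// => l /negbTE li.
  by rewrite mxE li mul0r.
pose dmono (a : {ffun 'I_d.+1 -> 'I_p.+1}) j k := (a k - (k == j))%N.
(* Summing over pairs makes the derivative a single combination of barycentric monomials, as
   [refInt_bary] expects. *)
have dE x : partialC i h x = \sum_(u : {ffun 'I_d.+1 -> 'I_p.+1} * 'I_d.+1 | S u.1 && true)
    c u.1 * ((u.1 u.2)%:R * toC (lam_grad v u.2 i)) * mono (dmono u.1 u.2) (lam v x).
  rewrite -(pair_big S xpredT (fun a j => c a * ((a j)%:R * toC (lam_grad v j i)) *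
     mono (dmono a j) (lam v x))) /=.
  apply: has_partialE; rewrite (funext hE).
  apply: has_partial_sum => a; under eq_bigr do rewrite -mulrA.
  rewrite -mulr_sumr; apply: has_partialZ.
  exact: (has_partial_mono (fun k => (a k : nat)) (dlam x)).
under eq_fun do rewrite dE lam_mapK//.
rewrite refInt_bary -(pair_big S xpredT (fun a j => c a * ((a j)%:R * toC (lam_grad v j i)) *
     toC (bary_weight R (dmono a j)))) /=.
have trE (j : 'I_d.+1) : refInt (traceF v j h) = \sum_(a | S a)
    c a * (a j == 0%N :> nat)%:R * toC (bary_weight R (fun l => (a (lift j l) : nat))).
  rewrite -refInt_bary; congr refInt; apply/funext => s; rewrite /traceF hE.
  by apply: eq_bigr => a _; rewrite lam_mapF// mono_insert0 mulrA.
under [RHS]eq_bigr => j _ do rewrite trE (normal_lam_grad hK _ (hn (ltn_ord j))) mulr_sumr.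
rewrite [RHS]exchange_big mulr_sumr /=; apply: eq_bigr => a _.
rewrite [RHS](eq_bigr (fun j => c a * toC (- (`|\det (jacK v)| * lam_grad v j i) *
   ((a j == 0%N :> nat)%:R * bary_weight R (fun l => (a (lift j l) : nat))))))
   => [|j _]; last first.
  by rewrite !toCM toC_nat; ring.
rewrite [X in _ * X = _](eq_bigr (fun j => c a * toC (lam_grad v j i *
    ((a j)%:R * bary_weight R (dmono a j)))))
  => [|j _]; last by rewrite !toCM toC_nat; ring.
rewrite -!mulr_sumr mulrCA -!toC_sum -toCM; congr (_ * toC _).
apply/eqP; rewrite -subr_eq0 mulr_sumr -sumrB; apply/eqP.
rewrite (eq_bigr (fun j => `|\det (jacK v)| * ((\prod_k (a k)`!)%N%:R /
   (m + \sum_k a k)`!%:R) * lam_grad v j i)) => [|j _]; last first.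
  rewrite -(bary_weight_face (fun k => (a k : nat)) j).
  by move: (bary_weight _ _) (bary_weight _ _) => X Y; ring.
by rewrite -mulr_sumr lam_grad_sum// mulr0.
Qed.

Lemma ipK_by_parts p i f g : isPoly p f -> isPoly p g ->
  ipK v (partialC i f) g + ipK v f (partialC i g) =
  \sum_(j < d.+1) toC (n j 0 i) * ipF v j (traceF v j f) (traceF v j g).
Proof.
move=> pf pg; have pdf := (poly_partial i pf).1; have pdg := (poly_partial i pg).1.
have dfg : partialC i (fun x => f x * conjc (g x)) =
    fun x => partialC i f x * conjc (g x) + f x * conjc (partialC i g x).
  apply/funext => x; apply: has_partialE; apply: has_partialM.
    exact: (poly_partial i pf).2.1.
  by apply: has_partial_conj; exact: (poly_partial i pg).2.1.
have := divergence i (isPolyM pf (isPoly_conj pg)); rewrite dfg => D.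
transitivity (toC `|\det (jacK v)| * refInt (fun t =>
   partialC i f (Defs.mapK v t) * conjc (g (Defs.mapK v t)) +
   f (Defs.mapK v t) * conjc (partialC i g (Defs.mapK v t)))).
  rewrite !ipKE -mulrDr /refIp; congr (_ * _).
  have /isPoly_mapK pdf' := isPoly_le (leq_pred p) pdf.
  have /isPoly_mapK pdg' := isPoly_le (leq_pred p) pdg.
  have := refInt_lin 1 (isPolyM (pdf' v) (isPoly_conj (isPoly_mapK v pg)))
    (isPolyM (isPoly_mapK v pf) (isPoly_conj (pdg' v))).
  by rewrite mul1r => <-; congr refInt; apply/funext => t; rewrite mul1r.
rewrite D; apply: eq_bigr => j _.
by rewrite ipFE toCM [toC _ * toC (n _ _ _)]mulrC mulrA.
Qed.

Lemma isPoly_partial p i f : isPoly p f -> isPoly p (partialC i f).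
Proof. by move=> /(poly_partial i)[/(isPoly_le (leq_pred p))]. Qed.

Lemma isPoly_div p (u : 'I_d -> 'rV[R]_d -> C) :
  (forall i, isPoly p (u i)) -> isPoly p (divC u).
Proof. by move=> pu; apply: isPoly_sum => i _; exact: isPoly_partial. Qed.

Lemma isPoly_ndot p (w : 'rV[R]_d) (u : 'I_d -> 'rV[R]_d -> C) :
  (forall i, isPoly p (u i)) -> isPoly p (ndot w u).
Proof. by move=> pu; apply: isPoly_sum => i _; exact: isPolyZ. Qed.

Lemma div_by_parts p (u : 'I_d -> 'rV[R]_d -> C) q :
  (forall i, isPoly p (u i)) -> isPoly p q ->
  ipK v (divC u) q + ipKvec v u (gradC q) =
  \sum_(j < d.+1) ipF v j (traceF v j (ndot (n j) u)) (traceF v j q).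
Proof.
move=> pu pq.
have -> : ipK v (divC u) q = \sum_i ipK v (partialC i (u i)) q.
  have := @ipK_suml d v p _ (index_enum 'I_d) (fun _ => 1) (fun i => partialC i (u i)) q
    (fun i => isPoly_partial i (pu i)) pq.
  rewrite (eq_bigr (fun i => ipK v (partialC i (u i)) q)) => [<-|i _]; last by rewrite mul1r.
  by congr ipK; apply/funext => x; apply: eq_bigr => i _; rewrite mul1r.
rewrite /ipKvec -big_split /=.
under eq_bigr => i _ do rewrite (ipK_by_parts i (pu i) pq).
rewrite exchange_big /=; apply: eq_bigr => j _.
have := @ipF_suml d v p j _ (index_enum 'I_d) (fun i => toC (n j 0 i))
  (fun i => traceF v j (u i)) (traceF v j q)
  (fun i => isPoly_traceF v j (pu i)) (isPoly_traceF v j pq).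
by move=> <-.
Qed.

Lemma grad_by_parts p (w : 'I_d -> 'rV[R]_d -> C) q :
  (forall i, isPoly p (w i)) -> isPoly p q ->
  ipKvec v (gradC q) w + ipK v q (divC w) =
  \sum_(j < d.+1) ipF v j (traceF v j q) (traceF v j (ndot (n j) w)).
Proof.
move=> pw pq; have := congr1 conjc (div_by_parts pw pq).
rewrite conjcD (ipK_conj v (isPoly_div pw) pq) /ipKvec !conjc_sum addrC.
rewrite (eq_bigr (fun i => ipK v (gradC q i) (w i))) => [->|i _].
  apply: eq_bigr => j _; apply: (@ipF_conj _ _ p); apply: isPoly_traceF => //.
  exact: isPoly_ndot.
by apply: (@ipK_conj _ _ p) => //; exact: isPoly_partial.
Qed.
End Divergence.
End InnerProducts.

(** * Solvability of singular sesquilinear systems *)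

Section SesquilinearSystem.
Variables (R : realType) (N : nat).
Local Notation C := (complex R).
Variables (B : 'rV[C]_N -> 'rV[C]_N -> C) (L : 'rV[C]_N -> C).
Hypothesis Bl : forall a z1 z2 w, B (a *: z1 + z2) w = a * B z1 w + B z2 w.
Hypothesis Br : forall a z w1 w2, B z (a *: w1 + w2) = conjc a * B z w1 + B z w2.
Hypothesis Ll : forall a w1 w2, L (a *: w1 + w2) = conjc a * L w1 + L w2.
(** Stands in for injectivity: a null vector is allowed as long as it is also null as a test vector
    and for the load. *)
Hypothesis ker : forall z, (forall w, B z w = 0) -> (forall w, B w z = 0) /\ L z = 0.

(** The morphism [s] covers both slots of the form, identity for the first and conjugation for the
    second. *)
Lemma semilinear_coord (F : 'rV[C]_N -> C) (s : {rmorphism C -> C}) :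
  (forall a w1 w2, F (a *: w1 + w2) = s a * F w1 + F w2) ->
  forall w, F w = \sum_k s (w 0 k) * F (delta_mx 0 k).
Proof.
move=> Fl w; have F0 : F 0 = 0.
  have := Fl 1 0 0; rewrite scaler0 addr0 rmorph1 mul1r => /eqP.
  by rewrite -subr_eq subrr eq_sym => /eqP.
rewrite {1}(row_sum_delta w); elim: (index_enum _) => [|k r IH]; first by rewrite !big_nil.
by rewrite !big_cons Fl IH.
Qed.

(* The left kernel [K] of the system is contained in its right kernel up to
   conjugation; both have the same dimension, so every functional vanishing on
   [K] vanishes on the right kernel, hence is in the range. *)
Lemma sesquilinear_solvable : exists z, forall w, B z w = L w.
Proof.
pose M : 'M[C]_N := \matrix_(k, l) B (delta_mx 0 k) (delta_mx 0 l).
pose ell : 'rV[C]_N := \row_l L (delta_mx 0 l).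
pose cj : 'rV[C]_N -> 'rV[C]_N := fun w => map_mx conjc w.
have BM z w : B z w = (z *m M *m (cj w)^T) 0 0.
  rewrite (semilinear_coord (s := idfun) (F := fun z => B z w)) //.
  rewrite -mulmxA mxE; apply: eq_bigr => k _; congr (_ * _).
  rewrite (semilinear_coord (s := conjc) (F := B (delta_mx 0 k))) //.
  by rewrite mxE; apply: eq_bigr => l _; rewrite !mxE mulrC.
have LM w : L w = (ell *m (cj w)^T) 0 0.
  rewrite (semilinear_coord (s := conjc) (F := L)) //.
  by rewrite mxE; apply: eq_bigr => l _; rewrite !mxE mulrC.
suff /submxP[z zM] : (ell <= M)%MS by exists z => w; rewrite BM LM zM.
(* Conjugated because [B] is conjugate linear in its test slot. *)
pose Kc : 'M[C]_N := map_mx conjc (kermx M).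
have kerrow k : (forall w, B w (row k (kermx M)) = 0) /\ L (row k (kermx M)) = 0.
  apply: ker => w; rewrite BM -row_mul mulmx_ker row0 mul0mx mxE //.
have cjrow k : (cj (row k (kermx M)))^T = col k Kc^T.
  by rewrite /cj /Kc map_row tr_row.
have MKc : M *m Kc^T = 0.
  apply/matrixP => k l; rewrite [RHS]mxE.
  have := (kerrow l).1 (delta_mx 0 k); rewrite BM cjrow -mulmxA -rowE => <-.
  by rewrite [RHS]mxE !mxE; apply: eq_bigr => r _; rewrite !mxE.
have ellKc : ell *m Kc^T = 0.
  apply/rowP => l; rewrite [RHS]mxE; have := (kerrow l).2; rewrite LM cjrow => <-.
  by rewrite !mxE; apply: eq_bigr => r _; rewrite !mxE.
have KcS : (Kc <= kermx M^T)%MS.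
  by apply/sub_kermxP; rewrite -[LHS]trmxK trmx_mul trmxK MKc trmx0.
have Sub : (kermx M^T <= Kc)%MS.
  rewrite -(mxrank_leqif_sup KcS) !mxrank_ker mxrank_tr.
  by rewrite /Kc mxrank_map mxrank_ker.
(* [ell] is in the row space iff it annihilates [cokermx M], whose columns lie in the right kernel,
   spanned by the columns of the transpose of [Kc]. *)
rewrite submxE; apply/eqP.
have /submxP[D DE] : ((cokermx M)^T <= Kc)%MS.
  apply: submx_trans Sub; apply/sub_kermxP.
  by rewrite -trmx_mul mulmx_coker trmx0.
by rewrite -[cokermx M]trmxK DE trmx_mul mulmxA ellKc mul0mx.
Qed.
End SesquilinearSystem.

(** * The local problem *)

Section FaceOperators.
Variables (R : realType) (d p j : nat) (v : nat -> 'rV[R]_d).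
Local Notation C := (complex R).
Variables A Ainv : ('rV[R]_d.-1 -> C) -> ('rV[R]_d.-1 -> C).
Hypothesis A_ok : faceOp_ok p v j A.
Hypothesis Ainv_ok : faceInv_ok p A Ainv.
Implicit Types (phi psi : 'rV[R]_d.-1 -> C).

Lemma faceOp0 : A (fun _ => 0) = fun _ => 0.
Proof.
have [_ [Alin _]] := A_ok.
have := Alin (-1) _ _ (isPoly0 R p d.-1) (isPoly0 R p d.-1).
rewrite (_ : (fun s => _) = fun _ => 0); last by apply/funext => s; rewrite mulr0 addr0.
by move=> ->; apply/funext => s; rewrite mulN1r addNr.
Qed.

(** A nonzero difference would be sent to 0 by [A], against positivity. *)
Lemma faceOp_inj phi psi : isPoly p phi -> isPoly p psi -> A phi = A psi -> phi = psi.
Proof.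
move=> pphi ppsi E; have [_ [Alin [_ Apos]]] := A_ok.
have pd := isPoly_lin (-1) pphi ppsi.
have d0 : (fun s => -1 * phi s + psi s) = fun _ => 0.
  apply: contrapT => /(Apos _ pd); rewrite Alin// E.
  rewrite (_ : (fun s => _) = fun _ => 0); last by apply/funext => s; rewrite mulN1r addNr.
  by rewrite ipF0l ltxx.
apply/funext => s; have := congr1 (@^~ s) d0; rewrite /= mulN1r => /eqP.
by rewrite addrC subr_eq0 => /eqP.
Qed.

(** Linearity of the inverse is derived by applying [A] to both sides and using its injectivity on
    polynomials. *)
Lemma faceInv_lin (a : C) phi psi : isPoly p phi -> isPoly p psi ->
  Ainv (fun s => a * phi s + psi s) = fun s => a * Ainv phi s + Ainv psi s.
Proof.
move=> pphi ppsi; have [_ [Alin _]] := A_ok.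
have [pi1 E1] := Ainv_ok pphi; have [pi2 E2] := Ainv_ok ppsi.
have [pi3 E3] := Ainv_ok (isPoly_lin a pphi ppsi).
by apply: faceOp_inj => //; [exact: isPoly_lin | rewrite E3 Alin// E1 E2].
Qed.

Lemma faceInv0 : Ainv (fun _ => 0) = fun _ => 0.
Proof.
have [pi E] := Ainv_ok (isPoly0 R p d.-1).
by apply: faceOp_inj; rewrite ?E ?faceOp0//; exact: isPoly0.
Qed.

Lemma faceInv_real phi : isPoly p phi ->
  conjc (ipF v j (Ainv phi) phi) = ipF v j (Ainv phi) phi.
Proof.
move=> pphi; have [_ [_ [Asym _]]] := A_ok; have [pi E] := Ainv_ok pphi.
by rewrite (ipF_conj v j pi pphi) -{1}E Asym// E.
Qed.

(** With [psi = Ainv phi], the form equals [<psi, A psi> = <A psi, psi>], and [psi] is nonzero since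
    [A psi = phi]. *)
Lemma faceInv_pos phi : isPoly p phi -> phi <> (fun _ => 0) ->
  0 < ipF v j (Ainv phi) phi.
Proof.
move=> pphi phi0; have [_ [_ [Asym Apos]]] := A_ok; have [pi E] := Ainv_ok pphi.
have := Apos _ pi; rewrite Asym// E; apply.
by move=> i0; apply: phi0; rewrite -E i0 faceOp0.
Qed.

Lemma faceInv_ge0 phi : isPoly p phi -> 0 <= ipF v j (Ainv phi) phi.
Proof.
move=> pphi; have [->|phi0] := pselect (phi = fun _ => 0); first by rewrite ipF0r.
exact/ltW/faceInv_pos.
Qed.
End FaceOperators.

Section LocalProblem.
Variables (R : realType) (m : nat).
Local Notation d := m.+1.
Local Notation C := (complex R).
Variables (v : nat -> 'rV[R]_d) (p : nat) (kappa eta : R) (n : nat -> 'rV[R]_d).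
Variables A Ainv : nat -> ('rV[R]_d.-1 -> C) -> ('rV[R]_d.-1 -> C).
Hypothesis hK : \det (jacK v) != 0.
Hypotheses (hkappa : 0 < kappa) (heta : 0 < eta).
Hypothesis hn : forall j, (j < d.+1)%N -> outward_unit_normal v j (n j).
Hypothesis hA : forall j, (j < d.+1)%N -> faceOp_ok p v j (A j).
Hypothesis hAinv : forall j, (j < d.+1)%N -> faceInv_ok p (A j) (Ainv j).
Local Notation vfield := ('I_d -> 'rV[R]_d -> C).
Implicit Types (q f g : 'rV[R]_d -> C) (u w : vfield).

(** This and [fluxForm] unfold to the left-hand sides in [local_eqs], so solutions transfer by
    conversion. *)
Definition massForm f u q : C :=
  - 'i * toC (kappa / eta) * ipK v f q - ipKvec v u (gradC q)
  + \sum_(j < d.+1)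
      ipF v j (fun s => traceF v j (ndot (n j) u) s + Ainv j (traceF v j f) s)
              (traceF v j q).

Definition fluxForm f u w : C :=
  - 'i * toC (kappa * eta) * ipKvec v u w - ipK v f (divC w).

Lemma partialC_lin a i f g : isPoly p f -> isPoly p g ->
  partialC i (fun x => a * f x + g x) = fun x => a * partialC i f x + partialC i g x.
Proof.
move=> /(poly_partial i)[_ [df _]] /(poly_partial i)[_ [dg _]]; apply/funext => x.
by apply: has_partialE; apply: has_partialD => //; exact: has_partialZ.
Qed.

Lemma divC_lin a u w : (forall i, isPoly p (u i)) -> (forall i, isPoly p (w i)) ->
  divC (fun i x => a * u i x + w i x) = fun x => a * divC u x + divC w x.
Proof.
move=> pu pw; apply/funext => x; rewrite /divC mulr_sumr -big_split /=.
by apply: eq_bigr => i _; rewrite partialC_lin.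
Qed.

Lemma ndot_lin a (b : 'rV[R]_d) u w :
  ndot b (fun i x => a * u i x + w i x) = fun x => a * ndot b u x + ndot b w x.
Proof.
apply/funext => x; rewrite /ndot mulr_sumr -big_split /=.
by apply: eq_bigr => i _; rewrite mulrDr mulrCA.
Qed.

Lemma ipKvec_linl a u1 u2 w : (forall i, isPoly p (u1 i)) -> (forall i, isPoly p (u2 i)) ->
  (forall i, isPoly p (w i)) ->
  ipKvec v (fun i x => a * u1 i x + u2 i x) w = a * ipKvec v u1 w + ipKvec v u2 w.
Proof.
move=> p1 p2 pw; rewrite /ipKvec mulr_sumr -big_split /=.
by apply: eq_bigr => i _; rewrite (@ipK_lin _ _ _ p).
Qed.

Lemma ipKvec_linr a u w1 w2 : (forall i, isPoly p (u i)) -> (forall i, isPoly p (w1 i)) ->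
  (forall i, isPoly p (w2 i)) ->
  ipKvec v u (fun i x => a * w1 i x + w2 i x) = conjc a * ipKvec v u w1 + ipKvec v u w2.
Proof.
move=> p1 p2 pw; rewrite /ipKvec mulr_sumr -big_split /=.
by apply: eq_bigr => i _; rewrite (@ipK_linr _ _ _ p).
Qed.

Lemma ipKvec_conj u w : (forall i, isPoly p (u i)) -> (forall i, isPoly p (w i)) ->
  conjc (ipKvec v u w) = ipKvec v w u.
Proof.
by move=> pu pw; rewrite /ipKvec conjc_sum; apply: eq_bigr => i _; exact: (@ipK_conj _ _ _ p).
Qed.

Lemma isPoly_Ainv (j : 'I_d.+1) phi : isPoly p phi -> isPoly p (Ainv j phi).
Proof. by move=> /(hAinv (ltn_ord j))[]. Qed.

Lemma isPoly_flux (j : 'I_d.+1) f u : isPoly p f -> (forall i, isPoly p (u i)) ->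
  isPoly p (fun s => traceF v j (ndot (n j) u) s + Ainv j (traceF v j f) s).
Proof.
move=> pf pu; apply: isPolyD; first exact/isPoly_traceF/isPoly_ndot.
exact/isPoly_Ainv/isPoly_traceF.
Qed.

Lemma massForm_linl a f1 f2 u1 u2 q : isPoly p f1 -> isPoly p f2 ->
  (forall i, isPoly p (u1 i)) -> (forall i, isPoly p (u2 i)) -> isPoly p q ->
  massForm (fun x => a * f1 x + f2 x) (fun i x => a * u1 i x + u2 i x) q =
  a * massForm f1 u1 q + massForm f2 u2 q.
Proof.
move=> pf1 pf2 pu1 pu2 pq; rewrite /massForm (@ipK_lin _ _ _ p)// ipKvec_linl//; last first.
  by move=> i; exact: isPoly_partial.
rewrite (eq_bigr (fun j : 'I_d.+1 => a *
    ipF v j (fun s => traceF v j (ndot (n j) u1) s + Ainv j (traceF v j f1) s) (traceF v j q) +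
    ipF v j (fun s => traceF v j (ndot (n j) u2) s + Ainv j (traceF v j f2) s) (traceF v j q)));
  last first.
  move=> j _; rewrite -(@ipF_lin _ _ v p)//; [|exact: isPoly_flux..|exact: isPoly_traceF].
  congr ipF; apply/funext => s; rewrite ndot_lin.
  have := faceInv_lin (hA (ltn_ord j)) (hAinv (ltn_ord j)) a
    (isPoly_traceF v j pf1) (isPoly_traceF v j pf2).
  rewrite (_ : Ainv j (traceF v j (fun x => a * f1 x + f2 x)) =
     Ainv j (fun s => a * traceF v j f1 s + traceF v j f2 s))// => ->.
  by rewrite /traceF; ring.
by rewrite big_split /= -mulr_sumr; ring.
Qed.

Lemma massForm_linr a f u q1 q2 : isPoly p f -> (forall i, isPoly p (u i)) ->
  isPoly p q1 -> isPoly p q2 ->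
  massForm f u (fun x => a * q1 x + q2 x) =
  conjc a * massForm f u q1 + massForm f u q2.
Proof.
move=> pf pu p1 p2; rewrite /massForm (@ipK_linr _ _ _ p)//.
have -> : gradC (fun x => a * q1 x + q2 x) = fun i x => a * gradC q1 i x + gradC q2 i x.
  by apply/funext => i; rewrite /gradC partialC_lin.
rewrite ipKvec_linr//; [|by move=> i; exact: isPoly_partial..].
rewrite (eq_bigr (fun j : 'I_d.+1 => conjc a *
    ipF v j (fun s => traceF v j (ndot (n j) u) s + Ainv j (traceF v j f) s) (traceF v j q1) +
    ipF v j (fun s => traceF v j (ndot (n j) u) s + Ainv j (traceF v j f) s) (traceF v j q2)));
  last first.
  move=> j _; rewrite -(@ipF_linr _ _ v p)//; [exact: isPoly_flux|exact: isPoly_traceF..].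
move: (conjc a) => b; rewrite big_split /= -mulr_sumr.
move: (ipK _ _ _) (ipK _ _ _) (ipKvec _ _ _) (ipKvec _ _ _) (- 'i * _) => x1 x2 x3 x4 x5.
by ring.
Qed.

Lemma fluxForm_linl a f1 f2 u1 u2 w : isPoly p f1 -> isPoly p f2 ->
  (forall i, isPoly p (u1 i)) -> (forall i, isPoly p (u2 i)) -> (forall i, isPoly p (w i)) ->
  fluxForm (fun x => a * f1 x + f2 x) (fun i x => a * u1 i x + u2 i x) w =
  a * fluxForm f1 u1 w + fluxForm f2 u2 w.
Proof.
move=> pf1 pf2 pu1 pu2 pw; rewrite /fluxForm (@ipK_lin _ _ _ p)//; last exact: isPoly_div.
by rewrite ipKvec_linl//; ring.
Qed.

Lemma fluxForm_linr a f u w1 w2 : isPoly p f -> (forall i, isPoly p (u i)) ->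
  (forall i, isPoly p (w1 i)) -> (forall i, isPoly p (w2 i)) ->
  fluxForm f u (fun i x => a * w1 i x + w2 i x) =
  conjc a * fluxForm f u w1 + fluxForm f u w2.
Proof.
move=> pf pu p1 p2; rewrite /fluxForm divC_lin// (@ipK_linr _ _ _ p)//; [|exact: isPoly_div..].
rewrite ipKvec_linr//; move: (conjc a) (ipK _ _ _) (ipK _ _ _) (ipKvec _ _ _) (ipKvec _ _ _).
by move: (- 'i * _) => x b x1 x2 x3 x4; ring.
Qed.

(** * The homogeneous problem *)

Section Uniqueness.
Variables (f : 'rV[R]_d -> C) (u : vfield).
Hypotheses (pf : isPoly p f) (pu : forall i, isPoly p (u i)).
Hypothesis mass0 : forall q, isPoly p q -> massForm f u q = 0.
Hypothesis flux0 : forall w, (forall i, isPoly p (w i)) -> fluxForm f u w = 0.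

(** The normal flux cancels against the boundary term of [div_by_parts], leaving only the face
    operators on the boundary. *)
Lemma massForm_by_parts q : isPoly p q ->
  massForm f u q = - 'i * toC (kappa / eta) * ipK v f q + ipK v (divC u) q
    + \sum_(j < d.+1) ipF v j (Ainv j (traceF v j f)) (traceF v j q).
Proof.
move=> pq; rewrite /massForm.
rewrite (eq_bigr (fun j : 'I_d.+1 => ipF v j (traceF v j (ndot (n j) u)) (traceF v j q) +
    ipF v j (Ainv j (traceF v j f)) (traceF v j q))); last first.
  move=> j _; rewrite -[X in _ = X + _]mul1r -(@ipF_lin _ _ v p)//.
  - by congr ipF; apply/funext => s; rewrite mul1r.
  - exact/isPoly_traceF/isPoly_ndot.
  - exact/isPoly_Ainv/isPoly_traceF.
  - exact/isPoly_traceF.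
rewrite big_split /= -(div_by_parts hK hn pu pq).
by move: (ipKvec _ _ _) (\sum_(j < _) _) => X Y; ring.
Qed.

(* Testing with the solution itself: the volume terms are purely imaginary. *)
Lemma trace_eq0 (j : 'I_d.+1) : traceF v j f = fun _ => 0.
Proof.
pose S := \sum_(j < d.+1) ipF v j (Ainv j (traceF v j f)) (traceF v j f).
have pfj (k : 'I_d.+1) := isPoly_traceF v k pf.
have E1 := mass0 pf; rewrite massForm_by_parts// -/S in E1.
(* Conjugation turns [(f, div u)] into [(div u, f)], the term present in [E1]. *)
have E2 := congr1 conjc (flux0 pu); rewrite /fluxForm in E2.
rewrite conjcD !conjcM !conjcN conjci opprK ipKvec_conj// in E2.
rewrite conjc_toC (ipK_conj v pf (isPoly_div pu)) conjc0 in E2.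
have cS : conjc S = S.
  rewrite conjc_sum; apply: eq_bigr => k _.
  exact: (faceInv_real (hA (ltn_ord k)) (hAinv (ltn_ord k))).
have E3 : S = 'i * (toC (kappa / eta) * ipK v f f - toC (kappa * eta) * ipKvec v u u).
  move/eqP: E2; rewrite subr_eq0 => /eqP E2; move: E1; rewrite -E2 => /eqP.
  rewrite addrC addr_eq0 => /eqP ->.
  by move: (ipK _ _ _) (ipKvec _ _ _) ('i : C) => x y z; ring.
(* [S] is real and equals ['i] times a real number, so [S = - S]. *)
have S0 : S = 0.
  have := congr1 conjc E3; rewrite cS conjcM conjci conjcD conjcN.
  rewrite (conjcM (toC (kappa / eta))) (conjcM (toC (kappa * eta))) !conjc_toC.
  rewrite (ipK_conj v pf pf) ipKvec_conj// mulNr -E3 => /eqP.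
  by rewrite -addr_eq0 -mulr2n mulrn_eq0 /= => /eqP.
apply: contrapT => fj0.
have := faceInv_pos (hA (ltn_ord j)) (hAinv (ltn_ord j)) (pfj j) fj0.
move/eqP: S0; rewrite psumr_eq0 => [/allP /(_ j)|k _]; last first.
  exact: (faceInv_ge0 (hA (ltn_ord k)) (hAinv (ltn_ord k))).
by rewrite mem_index_enum => /(_ isT) /implyP /(_ isT) /eqP ->; rewrite ltxx.
Qed.

(** The residual [r] is a polynomial of degree at most [p]. Zero traces remove the boundary term of
    [grad_by_parts], so the second equation says that [r] is orthogonal to all test fields. *)
Lemma gradient_eq i : partialC i f = fun x => 'i * toC (kappa * eta) * u i x.
Proof.
pose r k := fun x => (- 'i * toC (kappa * eta)) * u k x + partialC k f x.
have pr k : isPoly p (r k) by apply: isPoly_lin => //; exact: isPoly_partial.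
have r0 : r i = fun _ => 0.
  apply: (ipK_eq0 hK (pr i)).
  (* Testing with only the [i]-th component nonzero isolates the norm of [r i]. *)
  pose w : vfield := fun k => if k == i then r i else fun _ => 0.
  have pw k : isPoly p (w k) by rewrite /w; case: ifP => // _; exact: isPoly0.
  have E1 := flux0 pw; have E2 := grad_by_parts hK hn pw pf.
  rewrite [RHS]big1 in E2; last by move=> j _; rewrite trace_eq0 ipF0l.
  have E3 : ipKvec v r w = 0.
    rewrite ipKvec_linl//; last by move=> k; exact: isPoly_partial.
    by rewrite -[RHS](addr0 0) -{1}E1 -E2 /fluxForm; ring.
  move: E3; rewrite /ipKvec (bigD1 i)//= {1}/w eqxx big1 ?addr0// => k ki.
  by rewrite /w (negbTE ki) ipK0r.
apply/funext => x; have /eqP := congr1 (@^~ x) r0; rewrite /r /= addrC !mulNr subr_eq0.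
by move=> /eqP.
Qed.

Lemma divergence_eq : divC u = fun x => 'i * toC (kappa / eta) * f x.
Proof.
pose r := fun x => (- 'i * toC (kappa / eta)) * f x + divC u x.
have pdu := isPoly_div pu.
have pr : isPoly p r by apply: isPoly_lin.
have r0 : r = fun _ => 0.
  apply: (ipK_eq0 hK pr); rewrite (@ipK_lin _ _ _ p)//.
  have := mass0 pr; rewrite massForm_by_parts// [X in _ + X]big1 ?addr0// => j _.
  by rewrite trace_eq0 (faceInv0 (hA (ltn_ord j)) (hAinv (ltn_ord j))) ipF0l.
apply/funext => x; have /eqP := congr1 (@^~ x) r0; rewrite /r /= addrC !mulNr subr_eq0.
by move=> /eqP.
Qed.

(* [f] and [u] are derivatives of each other up to nonzero constants, so their
   degree decreases for ever. *)
Lemma homogeneous_eq0 : f = (fun _ => 0) /\ forall i, u i = fun _ => 0.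
Proof.
have i0 : ('i : C) != 0 by exact: neq0Ci.
have ke : 'i * toC (kappa * eta) != 0 :> C.
  by rewrite mulf_neq0// toC_eq0 mulf_neq0// gt_eqF.
have kd : 'i * toC (kappa / eta) != 0 :> C.
  by rewrite mulf_neq0// toC_eq0 mulf_neq0 ?invr_eq0// gt_eqF.
have uE i : u i = fun x => ('i * toC (kappa * eta))^-1 * partialC i f x.
  by apply/funext => x; rewrite gradient_eq mulKf.
have fE : f = fun x => ('i * toC (kappa / eta))^-1 * divC u x.
  by apply/funext => x; rewrite divergence_eq mulKf.
(* Descent on a degree bound for [f]: passing to [u] lowers it by one, and taking the divergence
   does not raise it again. For constant [f] the gradient vanishes, hence [u] and then [f]. *)
have [k] : exists k, isPoly k f by exists p.
elim: k => [|k IH] pk.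
  have u0 i : u i = fun _ => 0.
    by rewrite uE (poly_partial i pk).2.2//; apply/funext => x; rewrite mulr0.
  split=> //; rewrite fE; apply/funext => x; rewrite /divC big1 ?mulr0// => i _.
  by rewrite u0; apply: has_partialE; exact: has_partial_cst.
apply: IH; rewrite fE; apply: isPolyZ; apply: isPoly_div => i.
by rewrite uE; apply: isPolyZ; exact: (poly_partial i pk).1.
Qed.
End Uniqueness.

(** * Existence and uniqueness for given data *)

Variable phat : nat -> 'rV[R]_d.-1 -> C.
Hypothesis hphat : forall j, (j < d.+1)%N -> isPoly p (phat j).

Definition massLoad q : C :=
  \sum_(j < d.+1) ipF v j (Ainv j (phat j)) (traceF v j q).

Definition fluxLoad w : C :=
  - \sum_(j < d.+1) ipF v j (phat j) (traceF v j (ndot (n j) w)).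

Lemma massLoad_lin a q1 q2 : isPoly p q1 -> isPoly p q2 ->
  massLoad (fun x => a * q1 x + q2 x) = conjc a * massLoad q1 + massLoad q2.
Proof.
move=> p1 p2; rewrite /massLoad mulr_sumr -big_split /=; apply: eq_bigr => j _.
apply: (@ipF_linr _ _ v p); [|exact: isPoly_traceF..].
exact/isPoly_Ainv/hphat.
Qed.

Lemma fluxLoad_lin a w1 w2 : (forall i, isPoly p (w1 i)) -> (forall i, isPoly p (w2 i)) ->
  fluxLoad (fun i x => a * w1 i x + w2 i x) = conjc a * fluxLoad w1 + fluxLoad w2.
Proof.
move=> p1 p2; rewrite /fluxLoad mulrN -opprD mulr_sumr -big_split /=; congr (- _).
apply: eq_bigr => j _; rewrite ndot_lin.
apply: (@ipF_linr _ _ v p); [exact: hphat|exact/isPoly_traceF/isPoly_ndot..].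
Qed.

Local Notation idx := ('I_d.+1 * {ffun 'I_d -> 'I_p.+1})%type.
Local Notation N := #|{: idx}|.

(* Component [ord0] of a coefficient vector encodes the scalar unknown, the
   components [lift ord0 i] encode the vector unknown. *)
Definition polyOf (z : 'rV[C]_N) (k : 'I_d.+1) (x : 'rV[R]_d) : C :=
  \sum_(a : {ffun 'I_d -> 'I_p.+1} | (\sum_(i < d) (a i : nat) <= p)%N)
     z 0 (enum_rank (k, a)) * \prod_(i < d) toC (x 0 i) ^+ (a i : nat).

Lemma isPoly_polyOf z k : isPoly p (polyOf z k).
Proof.
exists [ffun a => z 0 (enum_rank (k, a))] => x.
by apply: eq_bigr => a _; rewrite ffunE.
Qed.

Lemma polyOf_lin a z1 z2 k :
  polyOf (a *: z1 + z2) k = fun x => a * polyOf z1 k x + polyOf z2 k x.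
Proof.
apply/funext => x; rewrite /polyOf mulr_sumr -big_split /=.
by apply: eq_bigr => b _; rewrite !mxE mulrDl mulrA.
Qed.

Lemma polyOf_surj (F : 'I_d.+1 -> 'rV[R]_d -> C) : (forall k, isPoly p (F k)) ->
  exists z, forall k, polyOf z k = F k.
Proof.
move=> /choice[c cE].
exists (\row_r c (enum_val r).1 (enum_val r).2) => k; apply/funext => x.
by rewrite cE; apply: eq_bigr => a _; rewrite mxE enum_rankK.
Qed.

Let P z : 'rV[R]_d -> C := polyOf z ord0.
Let U z : vfield := fun i => polyOf z (lift ord0 i).

Lemma polyOf_pair q w : isPoly p q -> (forall i, isPoly p (w i)) ->
  exists z, P z = q /\ U z = w.
Proof.
move=> pq pw.
have [k|z zE] := @polyOf_surj (fun k => if unlift ord0 k is Some i then w i else q).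
  by case: unliftP => [i _|_].
exists z; split; first by rewrite /P zE unlift_none.
by apply/funext => i; rewrite /U zE liftK.
Qed.

Let pP z : isPoly p (P z) := isPoly_polyOf z ord0.
Let pU z i : isPoly p (U z i) := isPoly_polyOf z (lift ord0 i).

Let PE a z1 z2 : P (a *: z1 + z2) = fun x => a * P z1 x + P z2 x.
Proof. exact: polyOf_lin. Qed.

Let UE a z1 z2 : U (a *: z1 + z2) = fun i x => a * U z1 i x + U z2 i x.
Proof. by apply/funext => i; exact: polyOf_lin. Qed.

(** Writing zero as [-1 * 0 + 0] lets the semilinearity lemmas show that forms and loads vanish at
    the zero test function. *)
Let fun0E T : (fun _ : T => -1 * (0 : C) + 0) = fun _ => 0.
Proof. by apply/funext => x; rewrite mulr0 addr0. Qed.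

Let vfun0E : (fun _ => (fun _ => -1 * (0 : C) + 0)) = (fun _ => fun _ => 0) :> vfield.
Proof. by apply/funext => i; exact: fun0E. Qed.

Let conjN1 (z : C) : conjc (-1) * z + z = 0.
Proof. by rewrite conjcN conjc1 mulN1r addNr. Qed.

Lemma massForm0r f u : isPoly p f -> (forall i, isPoly p (u i)) ->
  massForm f u (fun _ => 0) = 0.
Proof.
by move=> pf pu; rewrite -{1}fun0E massForm_linr// ?conjN1//; exact: isPoly0.
Qed.

Lemma fluxForm0r f u : isPoly p f -> (forall i, isPoly p (u i)) ->
  fluxForm f u (fun _ _ => 0) = 0.
Proof.
by move=> pf pu; rewrite -{1}vfun0E fluxForm_linr// ?conjN1// => i; exact: isPoly0.
Qed.

Lemma massLoad0 : massLoad (fun _ => 0) = 0.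
Proof. by rewrite -{1}fun0E massLoad_lin ?conjN1//; exact: isPoly0. Qed.

Lemma fluxLoad0 : fluxLoad (fun _ _ => 0) = 0.
Proof. by rewrite -{1}vfun0E fluxLoad_lin ?conjN1// => i; exact: isPoly0. Qed.

(** The two equations are added into one sesquilinear system on coefficient vectors; testing with
    pairs [(q, 0)] and [(0, w)] separates them again. *)
Lemma local_problem_exists : exists f u, isPoly p f /\ (forall i, isPoly p (u i)) /\
  (forall q, isPoly p q -> massForm f u q = massLoad q) /\
  (forall w, (forall i, isPoly p (w i)) -> fluxForm f u w = fluxLoad w).
Proof.
have [||||z zE] := @sesquilinear_solvable R N
  (fun z w : 'rV[C]_N => massForm (P z) (U z) (P w) + fluxForm (P z) (U z) (U w))
  (fun w : 'rV[C]_N => massLoad (P w) + fluxLoad (U w)).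
- by move=> a z1 z2 w; rewrite PE UE massForm_linl// fluxForm_linl// addrACA -mulrDr.
- by move=> a z w1 w2; rewrite PE UE massForm_linr// fluxForm_linr// addrACA -mulrDr.
- by move=> a w1 w2; rewrite PE UE massLoad_lin// fluxLoad_lin// addrACA -mulrDr.
- move=> z z0.
  (* A null coefficient vector need not be zero, but it encodes the zero pair, which suffices for
     [ker]. *)
  have [P0 U0] : P z = (fun _ => 0) /\ forall i, U z i = fun _ => 0.
    apply: homogeneous_eq0 => // [q pq|w pw].
      have [y [yP yU]] := polyOf_pair pq (fun _ => isPoly0 R p d).
      by have := z0 y; rewrite yP yU fluxForm0r// addr0.
    have [y [yP yU]] := polyOf_pair (isPoly0 R p d) pw.
    by have := z0 y; rewrite yP yU massForm0r// add0r.
  have {}U0 : U z = fun _ _ => 0 by apply/funext.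
  rewrite P0 U0; split=> [w|]; last by rewrite massLoad0 fluxLoad0; exact: addr0.
  by rewrite (massForm0r (pP w) (pU w)) (fluxForm0r (pP w) (pU w)); exact: addr0.
exists (P z), (U z); split=> //; split=> //; split=> [q pq|w pw].
  have [y [yP yU]] := polyOf_pair pq (fun _ => isPoly0 R p d).
  by have := zE y; rewrite yP yU fluxForm0r// fluxLoad0 !addr0.
have [y [yP yU]] := polyOf_pair (isPoly0 R p d) pw.
by have := zE y; rewrite yP yU massForm0r// massLoad0 !add0r.
Qed.

Lemma local_problem_well_posed : exists! sol : ('rV[R]_d -> C) * vfield,
  isPoly p sol.1 /\ (forall i, isPoly p (sol.2 i)) /\
  local_eqs p v kappa eta n Ainv phat sol.1 sol.2.
Proof.
have [f [u [pf [pu [mass flux]]]]] := local_problem_exists.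
exists (f, u); split=> // -[f' u'] /= [pf' [pu' [mass' flux']]].
have [df du] : (fun x => -1 * f x + f' x) = (fun _ => 0) /\
    forall i, (fun x => -1 * u i x + u' i x) = fun _ => 0.
  apply: homogeneous_eq0 => [|i|q pq|w pw]; try exact: isPoly_lin.
    rewrite massForm_linl// mass// (_ : massForm f' u' q = massLoad q) ?mulN1r ?addNr//.
    exact: mass'.
  rewrite fluxForm_linl// flux// (_ : fluxForm f' u' w = fluxLoad w) ?mulN1r ?addNr//.
  exact: flux'.
congr pair; first apply/funext => x.
  by have /eqP := congr1 (@^~ x) df; rewrite /= mulN1r addrC subr_eq0 => /eqP.
apply/funext => i; apply/funext => x.
by have /eqP := congr1 (@^~ x) (du i); rewrite /= mulN1r addrC subr_eq0 => /eqP.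
Qed.
End LocalProblem.

Theorem mainTheorem2 (R : realType) (d : nat) (hd : d = 2%N \/ d = 3%N)
  (v : nat -> 'rV[R]_d) (hK : \det (jacK v) != 0)
  (p : nat) (kappa eta : R) (hkappa : 0 < kappa) (heta : 0 < eta)
  (n : nat -> 'rV[R]_d)
  (hn : forall j, (j < d.+1)%N -> outward_unit_normal v j (n j))
  (A Ainv : nat -> ('rV[R]_d.-1 -> complex R) -> ('rV[R]_d.-1 -> complex R))
  (hA : forall j, (j < d.+1)%N -> faceOp_ok p v j (A j))
  (hAinv : forall j, (j < d.+1)%N -> faceInv_ok p (A j) (Ainv j))
  (phat : nat -> 'rV[R]_d.-1 -> complex R)
  (hphat : forall j, (j < d.+1)%N -> isPoly p (phat j)) :
  exists! sol : ('rV[R]_d -> complex R) * ('I_d -> 'rV[R]_d -> complex R),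
    isPoly p sol.1 /\ (forall i, isPoly p (sol.2 i)) /\
    local_eqs p v kappa eta n Ainv phat sol.1 sol.2.
Proof. by case: hd => hd; subst d; exact: local_problem_well_posed hA hAinv phat hphat. Qed.
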